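(* Let $Z=z_1e_1+z_2e_2$ and $\mathcal V=\nu_1e_1+\nu_2e_2$ be elements of $\mathbb{BC}$. Then, with $\mathcal J'_{\mathcal V}=\frac{d}{dZ}\mathcal J_{\mathcal V}$, (i) $Z\mathcal J'_{\mathcal V}(Z)+\mathcal V\mathcal J_{\mathcal V}(Z)=Z\mathcal J_{\mathcal V-1}(Z)$; (ii) $Z\mathcal J'_{\mathcal V}(Z)+Z\mathcal J_{\mathcal V+1}(Z)=\mathcal V\mathcal J_{\mathcal V}(Z)$.
   Context: Bicomplex numbers: $\mathbb{BC}=\{\lambda_1+j\lambda_2:\lambda_1,\lambda_2\in\mathbb C(i)\}$ with commuting units $i,j$, $i^2=j^2=-1$, $k=ij$, $k^2=1$. Put $e_1=\frac{1+k}{2}$, $e_2=\frac{1-k}{2}$; then $e_1+e_2=1$, $e_l^2=e_l$, $e_1e_2=0$. Every $Z=\lambda_1+j\lambda_2$ has the unique idempotent representation $Z=z_1e_1+z_2e_2$ with $z_1=\lambda_1-i\lambda_2$, $z_2=\lambda_1+i\lambda_2\in\mathbb C(i)$. The set of zero divisors is $\mathcal O_2=\{\lambda_1+j\lambda_2:\lambda_1^2+\lambda_2^2=0\}=\{Z: z_1z_2=0\}$. Derivative: $g'(Z_0)=\lim_{Z\to Z_0,\ Z-Z_0\notin\mathcal O_2}\frac{g(Z)-g(Z_0)}{Z-Z_0}$; for $g(Z)=g_1(z_1)e_1+g_2(z_2)e_2$ this is $g_1'(z_1)e_1+g_2'(z_2)e_2$. Powers and Gamma: $Z^{\mathcal V}=z_1^{\nu_1}e_1+z_2^{\nu_2}e_2$,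 with complex powers $z^\nu=\exp(\nu\log z)$ for a fixed branch of $\log$ holomorphic near the point considered and used consistently (at $z=0$ only when the powers involved make sense). $\Gamma_b(Z)=\Gamma(z_1)e_1+\Gamma(z_2)e_2$; reciprocals $1/\Gamma$ are read as the entire function $1/\Gamma$, and a term whose coefficient is zero is zero. Bicomplex Bessel function: for $\mathcal V,Z\in\mathbb{BC}$, $$\mathcal J_{\mathcal V}(Z)=\sum_{s=0}^\infty\frac{(-1)^s}{\Gamma_b(\mathcal V+s+1)s!}\left(\frac Z2\right)^{\mathcal V+2s},$$ equivalently $\mathcal J_{\mathcal V}(Z)=J_{\nu_1}(z_1)e_1+J_{\nu_2}(z_2)e_2$ with $J_\nu$ the classical Bessel function of the first kind. *)

(* Defs.v *)
From Stdlib Require Import Reals Factorial Lra.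
From Coquelicot Require Import Coquelicot.

Open Scope C_scope.

(** * Complex exponential, powers, reciprocal Gamma function *)

Definition Cexp (z : C) : C :=
  (exp (Re z) * cos (Im z), exp (Re z) * sin (Im z))%R.

(* [L] plays the role of the chosen branch of log.  At [z = 0] the value is the
   usual one, 0^0 = 1 and 0^nu = 0 for Re nu > 0; for the other exponents it is
   a dummy value. *)
Definition Cpower (L : C -> C) (z nu : C) : C :=
  if Ceq_dec z 0 then (if Ceq_dec nu 0 then 1 else 0) else Cexp (nu * L z).

Definition log_near (L : C -> C) (z : C) : Prop :=
  locally z (fun w : C => Cexp (L w) = w /\
    @ex_derive C_AbsRing C_NormedModule L w).

(* When the powers (z/2)^(nu+2s), (z/2)^(nu-1+2s) entering the Bessel function
   J_nu and its derivative make sense at [z].  No branch of log is continuous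
   around 0, so for [z = 0] either nu is an integer (the values w^nu then do not
   depend on the determination of log w), or Re (nu - 1) > 0 and the
   determination has bounded argument, so that w^(nu-1) -> 0 = 0^(nu-1). *)
Definition powers_defined (L : C -> C) (nu z : C) : Prop :=
  (z <> 0 /\ log_near L (z / 2))
  \/ (z = 0 /\ (exists n : Z, nu = IZR n) /\
      locally' (0 : C) (fun w : C => Cexp (L w) = w))
  \/ (z = 0 /\ (1 < Re nu)%R /\
      exists M : R,
        locally' (0 : C) (fun w : C => Cexp (L w) = w /\ (Rabs (Im (L w)) <= M)%R)).

Fixpoint rising (z : C) (n : nat) : C :=
  match n with
  | O => 1
  | S m => rising z m * (z + INR m)
  end.

(* Limits in C and sums in C and BC are taken coordinatewise; like [Lim_seq] and
   [Series], these total operators are meaningful when the limit exists. *)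
Definition C_Lim_seq (u : nat -> C) : C :=
  (real (Lim_seq (fun n => Re (u n))), real (Lim_seq (fun n => Im (u n)))).

Definition C_Series (a : nat -> C) : C :=
  C_Lim_seq (fun n => sum_n a n).

Lemma is_C_lim_seq_unique (u : nat -> C) (l : C) :
  filterlim u eventually (locally l) -> C_Lim_seq u = l.
Proof.
intros H; destruct l as [x y]; unfold C_Lim_seq; f_equal.
- rewrite (is_lim_seq_unique (fun n => Re (u n)) x); [reflexivity|].
  intros P [eps HP]; apply (H (fun w : C => P (Re w))).
  exists eps; intros w [Hw _]; exact (HP _ Hw).
- rewrite (is_lim_seq_unique (fun n => Im (u n)) y); [reflexivity|].
  intros P [eps HP]; apply (H (fun w : C => P (Im w))).
  exists eps; intros w [_ Hw]; exact (HP _ Hw).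
Qed.

Lemma is_C_series_unique (a : nat -> C) (l : C) :
  is_series a l -> C_Series a = l.
Proof. intros H; apply is_C_lim_seq_unique; exact H. Qed.

(* The entire function 1/Gamma, by Gauss's formula
   Gamma(z) = lim n! n^z / (z (z+1) ... (z+n)). *)
Definition C_rGamma (z : C) : C :=
  C_Lim_seq (fun n => rising z (S n) / (INR (fact n) * Cexp (z * ln (INR n)))).

(** * Bicomplex numbers *)

(* The pair (l1, l2) stands for l1 + j l2. *)
Definition BC : Type := (C * C)%type.

Definition BC_UniformSpace : UniformSpace :=
  UniformSpace.Pack BC
    (UniformSpace.class (prod_UniformSpace C_UniformSpace C_UniformSpace)) BC.
Canonical BC_UniformSpace.

Definition CtoBC (z : C) : BC := (z, RtoC 0).
Coercion CtoBC : C >-> BC.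

Definition BCplus (Z W : BC) : BC := (fst Z + fst W, snd Z + snd W).
Definition BCopp (Z : BC) : BC := (- fst Z, - snd Z).
Definition BCminus (Z W : BC) : BC := BCplus Z (BCopp W).
Definition BCmult (Z W : BC) : BC :=
  (fst Z * fst W - snd Z * snd W, fst Z * snd W + snd Z * fst W).
Definition BCinv (Z : BC) : BC :=
  let d := fst Z * fst Z + snd Z * snd Z in (fst Z / d, - snd Z / d).
Definition BCdiv (Z W : BC) : BC := BCmult Z (BCinv W).

Declare Scope BC_scope.
Delimit Scope BC_scope with BC.
Bind Scope BC_scope with BC.
Infix "+" := BCplus : BC_scope.
Notation "- Z" := (BCopp Z) : BC_scope.
Infix "-" := BCminus : BC_scope.
Infix "*" := BCmult : BC_scope.
Notation "/ Z" := (BCinv Z) : BC_scope.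
Infix "/" := BCdiv : BC_scope.

Definition zero_divisors (Z : BC) : Prop :=
  fst Z * fst Z + snd Z * snd Z = 0.

Definition BCi : BC := Ci.
Definition BCj : BC := (RtoC 0, RtoC 1).
Definition BCk : BC := (BCi * BCj)%BC.
Definition e1 : BC := ((RtoC 1 + BCk) / RtoC 2)%BC.
Definition e2 : BC := ((RtoC 1 - BCk) / RtoC 2)%BC.

Definition idem1 (Z : BC) : C := fst Z - Ci * snd Z.
Definition idem2 (Z : BC) : C := fst Z + Ci * snd Z.
Definition of_idem (z1 z2 : C) : BC := (z1 * e1 + z2 * e2)%BC.

Lemma BC_ring_theory :
  ring_theory (RtoC 0 : BC) (RtoC 1 : BC) BCplus BCmult BCminus BCopp eq.
Proof.
constructor; intros; try reflexivity;
  repeat match goal with Z : BC |- _ => destruct Z end;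
  unfold BCplus, BCmult, BCopp, CtoBC; simpl; f_equal; ring.
Qed.
Add Ring BC_ring : BC_ring_theory.

Lemma BCinv_r (Z : BC) : ~ zero_divisors Z -> (Z * / Z)%BC = RtoC 1.
Proof.
destruct Z as [a b]; unfold zero_divisors, BCmult, BCinv, CtoBC; simpl; intros H.
set (d := a * a + b * b) in *.
f_equal.
- transitivity (d * / d); [unfold d, Cdiv; ring | apply Cinv_r; exact H].
- unfold Cdiv; ring.
Qed.

Lemma C2_neq_0 : RtoC 2 <> 0.
Proof. intros H; apply RtoC_inj in H; lra. Qed.

Lemma e1E : e1 = (/ 2, Ci / 2).
Proof.
pose proof C2_neq_0 as H2.
unfold e1, BCdiv, BCmult, BCinv, BCk, BCi, BCj, BCplus, CtoBC; simpl.
f_equal; field; exact H2.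
Qed.

Lemma e2E : e2 = (/ 2, - Ci / 2).
Proof.
pose proof C2_neq_0 as H2.
unfold e2, BCdiv, BCmult, BCinv, BCk, BCi, BCj, BCplus, BCminus, BCopp, CtoBC; simpl.
f_equal; field; exact H2.
Qed.
Lemma Ci2 : Ci * Ci = - RtoC 1.
Proof. unfold Ci, Cmult, Copp, RtoC; simpl; f_equal; ring. Qed.

Lemma of_idemE (Z : BC) : of_idem (idem1 Z) (idem2 Z) = Z.
Proof.
pose proof C2_neq_0 as H2.
destruct Z as [a b]; unfold of_idem, idem1, idem2; rewrite e1E, e2E.
unfold BCplus, BCmult, CtoBC; simpl; f_equal.
- field; exact H2.
- transitivity (- (Ci * Ci) * b); [field; exact H2 | rewrite Ci2; ring].
Qed.

Lemma idem1_of_idem (z1 z2 : C) : idem1 (of_idem z1 z2) = z1.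
Proof.
pose proof C2_neq_0 as H2.
unfold of_idem, idem1; rewrite e1E, e2E.
unfold BCplus, BCmult, CtoBC; simpl.
transitivity ((z1 + z2) / 2 - (Ci * Ci) * (z1 - z2) / 2);
  [field; exact H2 | rewrite Ci2; field; exact H2].
Qed.

Lemma idem2_of_idem (z1 z2 : C) : idem2 (of_idem z1 z2) = z2.
Proof.
pose proof C2_neq_0 as H2.
unfold of_idem, idem2; rewrite e1E, e2E.
unfold BCplus, BCmult, CtoBC; simpl.
transitivity ((z1 + z2) / 2 + (Ci * Ci) * (z1 - z2) / 2);
  [field; exact H2 | rewrite Ci2; field; exact H2].
Qed.

Definition is_BC_derive (g : BC -> BC) (Z0 D : BC) : Prop :=
  filterlim (fun Z : BC => ((g Z - g Z0) / (Z - Z0))%BC)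
    (within (fun Z : BC => ~ zero_divisors (Z - Z0)%BC) (locally Z0))
    (locally D).

Definition BC_Series (a : nat -> BC) : BC :=
  (C_Series (fun n => fst (a n)), C_Series (fun n => snd (a n))).

(* One branch of log for each idempotent component. *)
Definition BCpower (L1 L2 : C -> C) (Z V : BC) : BC :=
  of_idem (Cpower L1 (idem1 Z) (idem1 V)) (Cpower L2 (idem2 Z) (idem2 V)).

Definition BC_rGamma (Z : BC) : BC :=
  of_idem (C_rGamma (idem1 Z)) (C_rGamma (idem2 Z)).

Definition BesselJ (L1 L2 : C -> C) (V Z : BC) : BC :=
  BC_Series (fun s : nat =>
    (RtoC ((-1) ^ s / INR (fact s))%R * BC_rGamma (V + RtoC (INR s) + RtoC 1)
     * BCpower L1 L2 (Z / RtoC 2) (V + RtoC (2 * INR s)%R))%BC).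

(* Main.v *)
Require Import Defs.
From Stdlib Require Import ZArith Reals Factorial Lra Lia.
From Coquelicot Require Import Coquelicot.

(* The idempotent components decouple, so the identities are proved for the
   classical J_nu.  From 1/Gamma(z) = z/Gamma(z+1), which follows from the
   convergence of Gauss's product, the coefficients of J_nu are bounded by
   M / s!, so J_nu(z) = (z/2)^nu F_nu((z/2)^2) with F_nu entire,
   F_nu' = - F_(nu+1) and F_(nu-1)(w) = nu F_nu(w) - w F_(nu+1)(w).  Together
   with d/du u^nu = nu u^nu / u these give both identities for z <> 0.  At z = 0
   both reduce to nu J_nu(0) = 0, and only the existence of J_nu'(0) is left. *)

Local Open Scope C_scope.

(** * Series and derivatives over C *)

(** [C_Series], [C_Lim_seq] and [C_rGamma] are total, so their values mean something only once
    convergence is known: they are computed by exhibiting a limit and invoking its uniqueness. Gamma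
    itself never appears. Its reciprocal enters through the functional equation alone, which yields
    both the zeros at the nonpositive integers and the boundedness along [nu + s].

    The obstacle is z = 0, where the factor (z/2)^nu comes from a branch that is not continuous. For
    integer nu the zeros of 1/Gamma remove the negative powers, and the remaining natural powers do
    not depend on the branch. For Re nu > 1 the size of J_nu near 0 is enough, provided the argument
    stays bounded.

    The bicomplex limit splits because an increment avoids the zero divisors exactly when both of
    its idempotent components are nonzero. *)

Definition C_CompleteNormedModule : CompleteNormedModule C_AbsRing :=
  CompleteNormedModule.Pack C_AbsRing C
    (CompleteNormedModule.Class C_AbsRing C
      (NormedModule.class C_AbsRing C_NormedModule) C_CompleteSpace_mixin) C.

Lemma ex_C_series_le (a : nat -> C) (b : nat -> R) :
  (forall n, (Cmod (a n) <= b n)%R) -> ex_series b ->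
  @ex_series C_AbsRing C_NormedModule a.
Proof. exact (@ex_series_le C_AbsRing C_CompleteNormedModule a b). Qed.

(** The triangle inequality for partial sums, passed to the limit. It turns termwise second-order
    bounds into a bound on the Taylor remainder of a power series. *)
Lemma Cmod_is_series_le (a : nat -> C) (b : nat -> R) (l : C) (m : R) :
  @is_series C_AbsRing C_NormedModule a l -> is_series b m ->
  (forall n, (Cmod (a n) <= b n)%R) -> (Cmod l <= m)%R.
Proof.
intros Ha Hb Hab.
apply (is_lim_seq_le (fun n => Cmod (@sum_n C_AbelianGroup a n)) (sum_n b) (Cmod l) m).
- intros n.
  eapply Rle_trans; [apply (@norm_sum_n_m C_AbsRing C_NormedModule)|].
  apply sum_n_m_le; exact Hab.
- apply (filterlim_comp _ _ _ (@sum_n C_AbelianGroup a) (fun z : C => Cmod z) _ _ _ Ha).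
  exact (@filterlim_norm C_AbsRing C_NormedModule l).
- exact Hb.
Qed.

Lemma is_C_series_ex (a : nat -> C) :
  @ex_series C_AbsRing C_NormedModule a ->
  @is_series C_AbsRing C_NormedModule a (C_Series a).
Proof. intros [l Hl]; rewrite (is_C_series_unique a l Hl); exact Hl. Qed.

Lemma is_C_series_ext (a b : nat -> C) (l : C) : (forall n, a n = b n) ->
  @is_series C_AbsRing C_NormedModule a l -> @is_series C_AbsRing C_NormedModule b l.
Proof. exact (@is_series_ext C_AbsRing C_NormedModule a b l). Qed.

(** Removes the filters from [is_derive]: each concrete derivative below becomes one estimate on
    [Cmod]. The point quantified in the library definition is a limit of [locally z], hence equal to
    [z]. *)
Lemma is_C_derive_eps (f : C -> C) (z l : C) :
  @is_derive C_AbsRing C_NormedModule f z l <->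
  (forall eps : R, (0 < eps)%R -> exists d : R, (0 < d)%R /\ forall y : C,
     (Cmod (y - z) < d)%R -> (Cmod (f y - f z - (y - z) * l) <= eps * Cmod (y - z))%R).
Proof.
split.
- intros [_ H] eps Heps.
  destruct (H z (fun P HP => HP) (mkposreal eps Heps)) as [d Hd].
  exists d; split; [apply cond_pos|]; intros y Hy; exact (Hd y Hy).
- intros H; split; [apply is_linear_scal_l|].
  intros x Hx eps.
  assert (Ex : z = x) by exact (is_filter_lim_locally_unique
    (V := AbsRing_NormedModule C_AbsRing) z x Hx).
  subst x; destruct (H eps (cond_pos eps)) as [d [Hd Hy]].
  exists (mkposreal d Hd); intros y Hyd; exact (Hy y Hyd).
Qed.

(* The two structures have the same norm but not the same uniform structure: the
   balls of the first are squares, those of the second are discs. *)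
Lemma is_C_derive_AbsRing (f : C -> C) (x l : C) :
  @is_derive C_AbsRing C_NormedModule f x l <->
  @is_derive C_AbsRing (AbsRing_NormedModule C_AbsRing) f x l.
Proof. split; intros [_ H]; split; try apply is_linear_scal_l; exact H. Qed.

Lemma is_C_derive_mult (f g : C -> C) (x df dg : C) :
  @is_derive C_AbsRing C_NormedModule f x df ->
  @is_derive C_AbsRing C_NormedModule g x dg ->
  @is_derive C_AbsRing C_NormedModule (fun y => f y * g y)%C x (df * g x + f x * dg)%C.
Proof.
intros Hf Hg; apply is_C_derive_AbsRing in Hf, Hg; apply is_C_derive_AbsRing.
exact (@is_derive_mult C_AbsRing f g x df dg Hf Hg Cmult_comm).
Qed.

Lemma is_C_derive_comp (f g : C -> C) (x df dg : C) :
  @is_derive C_AbsRing C_NormedModule f (g x) df ->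
  @is_derive C_AbsRing C_NormedModule g x dg ->
  @is_derive C_AbsRing C_NormedModule (fun y => f (g y)) x (dg * df)%C.
Proof.
intros Hf Hg; apply is_C_derive_AbsRing in Hg.
exact (@is_derive_comp C_AbsRing C_NormedModule f g x df dg Hf Hg).
Qed.

Lemma locally_C_Cmod (z : C) (P : C -> Prop) :
  @locally C_UniformSpace z P <->
  exists d : R, (0 < d)%R /\ forall y : C, (Cmod (y - z) < d)%R -> P y.
Proof.
split.
- intros H; destruct (proj1 (locally_C z P) H) as [d Hd].
  exists d; split; [apply cond_pos|]; intros y Hy; exact (Hd y Hy).
- intros [d [Hd HP]]; apply (locally_C z P).
  exists (mkposreal d Hd); intros y Hy; exact (HP y Hy).
Qed.

(** * Second-order estimates for the complex exponential *)

Lemma Cmod_Ci : Cmod Ci = 1%R.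
Proof.
unfold Cmod, Ci; simpl; replace (0 * (0 * 1) + 1 * (1 * 1))%R with 1%R by ring; apply sqrt_1.
Qed.

Lemma Cmod_le_Rabs (z : C) : (Cmod z <= Rabs (Re z) + Rabs (Im z))%R.
Proof.
destruct z as [x y]; cbn [Re Im fst snd].
replace (x, y) with (RtoC x + Ci * RtoC y).
- eapply Rle_trans; [apply Cmod_triangle|].
  rewrite Cmod_mult, !Cmod_R, Cmod_Ci; lra.
- unfold Cplus, Cmult, Ci, RtoC; simpl; f_equal; ring.
Qed.

Lemma Cmod_sqr (z : C) : (Cmod z * Cmod z = Re z * Re z + Im z * Im z)%R.
Proof.
unfold Cmod; rewrite sqrt_sqrt; [simpl; unfold Re, Im; ring|].
destruct z as [x y]; simpl; nra.
Qed.

Lemma Cexp_plus (a b : C) : Cexp (a + b) = Cexp a * Cexp b.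
Proof.
destruct a as [x y], b as [u v].
unfold Cexp, Cplus, Cmult; cbn [Re Im fst snd]; rewrite exp_plus, cos_plus, sin_plus.
f_equal; ring.
Qed.

Lemma Cexp_0 : Cexp 0 = 1.
Proof.
unfold Cexp, RtoC; cbn [Re Im fst snd].
rewrite exp_0, cos_0, sin_0; f_equal; ring.
Qed.

Lemma Cmod_Cexp (z : C) : Cmod (Cexp z) = exp (Re z).
Proof.
unfold Cmod, Cexp; cbn [fst snd].
replace ((exp (Re z) * cos (Im z)) ^ 2 + (exp (Re z) * sin (Im z)) ^ 2)%R
  with (exp (Re z) * exp (Re z))%R.
- apply sqrt_square, Rlt_le, exp_pos.
- pose proof (sin2_cos2 (Im z)) as H; unfold Rsqr in H.
  transitivity (exp (Re z) * exp (Re z) * (sin (Im z) * sin (Im z) + cos (Im z) * cos (Im z)))%R;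
  [rewrite H|]; ring.
Qed.

Lemma Cexp_neq_0 (z : C) : Cexp z <> 0.
Proof.
intros H; pose proof (exp_pos (Re z)) as P; rewrite <- Cmod_Cexp, H, Cmod_0 in P; lra.
Qed.

Lemma exp_le (x y : R) : (x <= y)%R -> (exp x <= exp y)%R.
Proof. intros [H| ->]; [apply Rlt_le, exp_increasing, H|apply Rle_refl]. Qed.

(** Both sides come from 1 + t <= exp t. At t = -x, after multiplication by exp x, it gives exp x <=
    1/(1-x) = 1 + x + x^2/(1-x), and 1/(1-x) <= 2. *)
Lemma exp_taylor2 (x : R) : (Rabs x <= 1/2)%R ->
  (0 <= exp x - 1 - x <= 2 * (x * x))%R /\ (exp x <= 2)%R.
Proof.
intros Hx; apply Rabs_le_between in Hx.
pose proof (exp_ineq1_le x) as H1; pose proof (exp_ineq1_le (- x)) as H2.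
pose proof (exp_pos x) as P.
assert (E : (exp x * exp (- x) = 1)%R)
  by (rewrite <- exp_plus, Rplus_opp_r; apply exp_0).
assert (exp x * (1 - x) <= 1)%R by nra.
split; [split|]; nra.
Qed.

Lemma Rabs_sin_le (y : R) : (Rabs (sin y) <= Rabs y)%R.
Proof.
assert (P : forall t, (0 <= t)%R -> (Rabs (sin t) <= t)%R).
{ intros t [Ht|<-]; [|rewrite sin_0, Rabs_R0; lra].
  pose proof (sin_lt_x t Ht); pose proof (SIN_bound t).
  destruct (Rle_dec t 1).
  - rewrite Rabs_right; [lra|]; apply Rle_ge, sin_ge_0; pose proof PI2_1; lra.
  - apply Rabs_le; lra. }
destruct (Rle_dec 0 y) as [h|h].
- rewrite (Rabs_right y) by lra; auto.
- rewrite (Rabs_left y) by lra; rewrite <- (Ropp_involutive y) at 1.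
  rewrite sin_neg, Rabs_Ropp; apply P; lra.
Qed.

Lemma cos_taylor2 (y : R) : (0 <= 1 - cos y <= y * y / 2)%R.
Proof.
pose proof (COS_bound y).
split; [lra|].
replace y with (2 * (y / 2))%R at 1 by field.
rewrite cos_2a_sin.
pose proof (Rabs_sin_le (y / 2)) as H1.
apply Rsqr_le_abs_1 in H1; unfold Rsqr in H1; lra.
Qed.

Lemma sin_taylor2 (y : R) : (Rabs y <= 1/2)%R -> (Rabs (sin y - y) <= y * y)%R.
Proof.
assert (P : forall t, (0 <= t <= 1/2)%R -> (Rabs (sin t - t) <= t * t)%R).
{ intros t Ht.
  (* The lowest alternating bound is t - t^3/6 <= sin t; on [0, 1/2] the cubic term is below t^2. *)
  destruct (pre_sin_bound t 0) as [H1 _]; [lra|lra|].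
  assert (sin t <= t)%R by (destruct (proj1 Ht) as [h|<-];
    [apply Rlt_le, sin_lt_x; exact h|rewrite sin_0; lra]).
  unfold sin_approx, sin_term in H1; simpl in H1.
  apply Rabs_le; split; nra. }
intros Hy; apply Rabs_le_between in Hy.
destruct (Rle_dec 0 y) as [h|h]; [apply P; lra|].
rewrite <- Rabs_Ropp.
replace (- (sin y - y))%R with (sin (- y) - - y)%R by (rewrite sin_neg; ring).
replace (y * y)%R with (- y * - y)%R by ring.
apply P; lra.
Qed.

(** With h = x + iy, the real part of the remainder is at most 2x^2 + y^2 and the imaginary part at
    most 2|x||y| + y^2 <= x^2 + 2y^2; the sum is the constant 3. *)
Lemma Cexp_taylor2 (h : C) : (Cmod h <= 1/2)%R ->
  (Cmod (Cexp h - 1 - h) <= 3 * (Cmod h * Cmod h))%R.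
Proof.
intros Hh.
pose proof (Rmax_Cmod h) as Hm.
assert (Hx : (Rabs (Re h) <= 1/2)%R)
  by (eapply Rle_trans; [|exact Hh]; eapply Rle_trans; [|exact Hm]; apply Rmax_l).
assert (Hy : (Rabs (Im h) <= 1/2)%R)
  by (eapply Rle_trans; [|exact Hh]; eapply Rle_trans; [|exact Hm]; apply Rmax_r).
rewrite Cmod_sqr.
eapply Rle_trans; [apply Cmod_le_Rabs|].
destruct h as [x y]; unfold Cexp, Cminus, Cplus, Copp, RtoC in *; cbn [Re Im fst snd] in *.
destruct (exp_taylor2 x Hx) as [He He2].
pose proof (cos_taylor2 y) as Hc; pose proof (sin_taylor2 y Hy) as Hs.
pose proof (Rabs_sin_le y) as Hsy; pose proof (exp_pos x).
replace (exp x * cos y + - (1) + - x)%R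
  with ((exp x - 1 - x) - exp x * (1 - cos y))%R by ring.
replace (exp x * sin y + - 0 + - y)%R
  with ((x + (exp x - 1 - x)) * sin y + (sin y - y))%R by ring.
assert (A1 : (Rabs (exp x - 1 - x - exp x * (1 - cos y)) <= 2 * (x * x) + y * y)%R).
{ apply Rabs_le; split; nra. }
assert (A2 : (Rabs (x + (exp x - 1 - x)) <= 2 * Rabs x)%R).
{ eapply Rle_trans; [apply Rabs_triang|].
  rewrite (Rabs_right (exp x - 1 - x)) by lra.
  pose proof (Rsqr_abs x) as E; unfold Rsqr in E.
  pose proof (Rabs_pos x). nra. }
assert (A3 : (Rabs ((x + (exp x - 1 - x)) * sin y) <= 2 * Rabs x * Rabs y)%R).
{ rewrite Rabs_mult; apply Rmult_le_compat; try apply Rabs_pos; assumption. }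
pose proof (Rabs_triang ((x + (exp x - 1 - x)) * sin y) (sin y - y)) as A4.
pose proof (Rsqr_abs x) as Ex; unfold Rsqr in Ex.
pose proof (Rsqr_abs y) as Ey; unfold Rsqr in Ey.
pose proof (Rle_0_sqr (Rabs x - Rabs y)) as Hd; unfold Rsqr in Hd.
lra.
Qed.

(** The functional equation factors [Cexp z] out of the remainder, which reduces the claim to the
    estimate at 0. *)
Lemma is_derive_Cexp (z : C) : @is_derive C_AbsRing C_NormedModule Cexp z (Cexp z).
Proof.
apply is_C_derive_eps; intros eps Heps.
set (E := Cmod (Cexp z)).
assert (HE : (0 < E)%R) by (unfold E; rewrite Cmod_Cexp; apply exp_pos).
exists (Rmin (1/2) (eps / (3 * E))); split.
- apply Rmin_pos; [lra|]; apply Rdiv_lt_0_compat; lra.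
- intros y Hy.
  assert (H1 := Rlt_le_trans _ _ _ Hy (Rmin_l _ _)).
  assert (H2 := Rlt_le_trans _ _ _ Hy (Rmin_r _ _)).
  replace (Cexp y - Cexp z - (y - z) * Cexp z)
    with (Cexp z * (Cexp (y - z) - 1 - (y - z))).
  2:{ replace (Cexp y) with (Cexp z * Cexp (y - z)); [ring|].
      rewrite <- Cexp_plus; f_equal; ring. }
  rewrite Cmod_mult; fold E.
  assert (H3 : (E * (3 * (Cmod (y - z))) <= eps)%R).
  { apply Rlt_le, Rmult_lt_reg_l with (/ (3 * E))%R; [apply Rinv_0_lt_compat; lra|].
    replace (/ (3 * E) * eps)%R with (eps / (3 * E))%R by (unfold Rdiv; ring).
    replace (/ (3 * E) * (E * (3 * Cmod (y - z))))%R with (Cmod (y - z)); [exact H2|].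
    field; lra. }
  pose proof (Cexp_taylor2 (y - z) ltac:(lra)) as H4.
  pose proof (Cmod_ge_0 (y - z)).
  apply Rle_trans with (E * (3 * (Cmod (y - z) * Cmod (y - z))))%R; [apply Rmult_le_compat_l; lra|].
  nra.
Qed.

(** * Exponentially bounded power series *)

(** This form makes M exp|w| a majorant of the power series and is stable under differentiation with
    the same [M], since (n+1) M/(n+1)! = M/n!. *)
Definition exp_bounded (M : R) (a : nat -> C) : Prop :=
  forall n, (Cmod (a n) <= M / INR (fact n))%R.

Definition entire (a : nat -> C) (w : C) : C := C_Series (fun n => a n * w ^ n).

Definition deriv_coef (a : nat -> C) (n : nat) : C := RtoC (INR (S n)) * a (S n).

Lemma is_series_exp (x : R) : is_series (fun n => x ^ n / INR (fact n))%R (exp x).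
Proof.
apply is_series_ext with (2 := is_exp_Reals x); intros n.
rewrite pow_n_pow; reflexivity.
Qed.

Lemma exp_bounded_term (M : R) (a : nat -> C) (w : C) (n : nat) : exp_bounded M a ->
  (Cmod (a n * w ^ n) <= M * (Cmod w ^ n / INR (fact n)))%R.
Proof.
intros H; rewrite Cmod_mult, Cmod_pow.
replace (M * (Cmod w ^ n / INR (fact n)))%R with (M / INR (fact n) * Cmod w ^ n)%R
  by (unfold Rdiv; ring).
apply Rmult_le_compat_r; [apply pow_le, Cmod_ge_0|apply H].
Qed.

Lemma is_series_entire (M : R) (a : nat -> C) (w : C) : exp_bounded M a ->
  @is_series C_AbsRing C_NormedModule (fun n => a n * w ^ n) (entire a w).
Proof.
intros H; apply is_C_series_ex.
apply ex_C_series_le with (fun n => M * (Cmod w ^ n / INR (fact n)))%R.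
- intros n; apply exp_bounded_term; exact H.
- exists (M * exp (Cmod w))%R; apply (@is_series_scal R_AbsRing R_NormedModule M), is_series_exp.
Qed.

Lemma exp_bounded_deriv_coef (M : R) (a : nat -> C) : exp_bounded M a -> exp_bounded M (deriv_coef a).
Proof.
intros H n; unfold deriv_coef; rewrite Cmod_mult, Cmod_R, Rabs_right by apply Rle_ge, pos_INR.
apply Rle_trans with (INR (S n) * (M / INR (fact (S n))))%R;
  [apply Rmult_le_compat_l; [apply pos_INR|apply H]|].
rewrite fact_simpl, mult_INR; right; field; split; [apply INR_fact_neq_0|apply not_0_INR; lia].
Qed.

(** The factor (n+2)(n+1) is twice the sharp one; it cancels against (n+2)! in [exp_bounded] and
    leaves r^n/n!, again an exponential series. The first-order bound [D1] feeds the induction. *)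
Lemma Cpow_taylor2 (w h : C) (r : R) (n : nat) : (Cmod w <= r)%R -> (Cmod (w + h) <= r)%R ->
  (Cmod ((w + h) ^ S (S n) - w ^ S (S n) - h * (RtoC (INR (S (S n))) * w ^ S n))
   <= Cmod h * Cmod h * (INR (S (S n)) * INR (S n) * r ^ n))%R.
Proof.
intros Hw Hh; pose proof (Cmod_ge_0 w) as Hw0; pose proof (Cmod_ge_0 h) as Hh0.
assert (D1 : forall n, (Cmod ((w + h) ^ S n - w ^ S n) <= Cmod h * (INR (S n) * r ^ n))%R).
{ clear n; induction n as [|n IH].
  - replace ((w + h) ^ 1 - w ^ 1) with h by (rewrite !Cpow_1_r; ring); simpl; lra.
  - replace ((w + h) ^ S (S n) - w ^ S (S n))
      with ((w + h) * ((w + h) ^ S n - w ^ S n) + h * w ^ S n)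
      by (rewrite !(Cpow_S _ (S n)); ring).
    eapply Rle_trans; [apply Cmod_triangle|]; rewrite !Cmod_mult, Cmod_pow.
    assert (P1 : (Cmod w ^ S n <= r ^ S n)%R) by (apply pow_incr; lra).
    assert (P2 := Rmult_le_compat _ _ _ _ (Cmod_ge_0 _) (Cmod_ge_0 _) Hh IH).
    assert (P3 := Rmult_le_compat_l _ _ _ Hh0 P1).
    replace (Cmod h * (INR (S (S n)) * r ^ S n))%R
      with (r * (Cmod h * (INR (S n) * r ^ n)) + Cmod h * r ^ S n)%R
      by (rewrite (S_INR (S n)); simpl; ring).
    lra. }
assert (Hr : (0 <= r)%R) by lra.
induction n as [|n IH].
- replace ((w + h) ^ 2 - w ^ 2 - h * (RtoC (INR 2) * w ^ 1)) with (h * h).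
  + rewrite Cmod_mult; simpl; nra.
  + replace (RtoC (INR 2)) with (1 + 1) by (simpl; rewrite RtoC_plus; reflexivity).
    rewrite !Cpow_S; simpl; ring.
- set (k := S (S n)) in *.
  replace ((w + h) ^ S k - w ^ S k - h * (RtoC (INR (S k)) * w ^ k))
    with (w * ((w + h) ^ k - w ^ k - h * (RtoC (INR k) * w ^ S n))
          + h * ((w + h) ^ k - w ^ k)).
  2:{ rewrite (S_INR k), RtoC_plus; unfold k; rewrite !(Cpow_S _ (S (S n))), !(Cpow_S _ (S n)); ring. }
  eapply Rle_trans; [apply Cmod_triangle|]; rewrite !Cmod_mult.
  assert (P1 := Rmult_le_compat _ _ _ _ Hw0 (Cmod_ge_0 _) Hw IH).
  assert (P2 := Rmult_le_compat_l _ _ _ Hh0 (D1 (S n))); fold k in P2.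
  replace (Cmod h * Cmod h * (INR (S k) * INR k * r ^ S n))%R
    with (r * (Cmod h * Cmod h * (INR k * INR (S n) * r ^ n))
          + Cmod h * (Cmod h * (INR k * r ^ S n))
          + Cmod h * Cmod h * (INR k * r ^ S n))%R
    by (unfold k; rewrite !S_INR; simpl; ring).
  assert (0 <= Cmod h * Cmod h * (INR k * r ^ S n))%R;
    [|lra].
  apply Rmult_le_pos; [nra|]; apply Rmult_le_pos; [apply pos_INR|apply pow_le; lra].
Qed.

Lemma is_derive_entire (M : R) (a : nat -> C) (w : C) : exp_bounded M a ->
  @is_derive C_AbsRing C_NormedModule (entire a) w (entire (deriv_coef a) w).
Proof.
intros Ha.
assert (HM : (0 <= M)%R).
{ pose proof (Ha 0%nat) as H0; simpl in H0; pose proof (Cmod_ge_0 (a 0%nat)); lra. }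
set (r := (Cmod w + 1)%R).
assert (Q : forall h, (Cmod h <= 1)%R ->
  (Cmod (entire a (w + h) - entire a w - h * entire (deriv_coef a) w)
   <= Cmod h * Cmod h * (M * exp r))%R).
{ intros h Hh.
  assert (Hw1 : (Cmod w <= r)%R) by (unfold r; lra).
  assert (Hw2 : (Cmod (w + h) <= r)%R)
    by (eapply Rle_trans; [apply Cmod_triangle|]; unfold r; lra).
  (* The derived series is shifted by one index to align it termwise with the two series for
     [entire a]. *)
  set (u := fun n => match n with O => RtoC 0 | S m => deriv_coef a m * w ^ m end).
  assert (Hu : @is_series C_AbsRing C_NormedModule u (entire (deriv_coef a) w)).
  { apply (@is_series_decr_1 C_AbsRing C_NormedModule).
    match goal with |- is_series _ ?l => replace l with (entire (deriv_coef a) w) end.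
    2:{ change (entire (deriv_coef a) w = entire (deriv_coef a) w + - 0); ring. }
    apply is_series_entire with M, exp_bounded_deriv_coef, Ha. }
  (* The remainder of w^n vanishes for n = 0 and n = 1, so the majorant starts at index 2. *)
  set (b := fun n => match n with
     | S (S m) => (Cmod h * Cmod h * (M * (r ^ m / INR (fact m))))%R | _ => 0%R end).
  assert (Hb : is_series b (Cmod h * Cmod h * (M * exp r))%R).
  { apply is_series_decr_1, is_series_decr_1; unfold b; simpl.
    match goal with |- is_series _ ?l =>
      replace l with (Cmod h * Cmod h * (M * exp r))%R
        by (unfold plus, opp; simpl; ring) end.
    apply (@is_series_scal R_AbsRing R_NormedModule (Cmod h * Cmod h)%R),
      (@is_series_scal R_AbsRing R_NormedModule M), is_series_exp. }
  apply Cmod_is_series_le with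
    (fun n => (a n * (w + h) ^ n - a n * w ^ n) - h * u n) b; [|exact Hb|].
  - apply (@is_series_minus C_AbsRing C_NormedModule);
      [apply (@is_series_minus C_AbsRing C_NormedModule); apply is_series_entire with M, Ha|].
    apply (@is_series_scal C_AbsRing C_NormedModule h), Hu.
  - intros [|[|n]].
    + simpl; match goal with |- (Cmod ?e <= _)%R => replace e with (RtoC 0) by ring end;
      rewrite Cmod_0; lra.
    + unfold u, deriv_coef; simpl;
      match goal with |- (Cmod ?e <= _)%R => replace e with (RtoC 0) by ring end;
      rewrite Cmod_0; lra.
    + unfold u, deriv_coef, b.
      replace (a (S (S n)) * (w + h) ^ S (S n) - a (S (S n)) * w ^ S (S n) -
         h * (RtoC (INR (S (S n))) * a (S (S n)) * w ^ S n))
        with (a (S (S n)) * ((w + h) ^ S (S n) - w ^ S (S n)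
              - h * (RtoC (INR (S (S n))) * w ^ S n))) by ring.
      rewrite Cmod_mult.
      eapply Rle_trans; [apply Rmult_le_compat;
        [apply Cmod_ge_0|apply Cmod_ge_0|apply Ha|apply Cpow_taylor2 with (r := r); assumption]|].
      rewrite !fact_simpl, !mult_INR; right; field.
      repeat split; try apply INR_fact_neq_0; apply not_0_INR; lia. }
apply is_C_derive_eps; intros eps Heps.
assert (HK : (0 <= M * exp r)%R) by (apply Rmult_le_pos; [lra|apply Rlt_le, exp_pos]).
(* The added 1 keeps the denominator positive when [M] is 0. *)
exists (Rmin 1 (eps / (M * exp r + 1))); split;
  [apply Rmin_pos; [lra|apply Rdiv_lt_0_compat; lra]|].
intros y Hy.
assert (H1 := Rlt_le_trans _ _ _ Hy (Rmin_l _ _)).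
assert (H2 := Rlt_le_trans _ _ _ Hy (Rmin_r _ _)).
pose proof (Q (y - w) (Rlt_le _ _ H1)) as H3.
replace (w + (y - w)) with y in H3 by ring.
eapply Rle_trans; [exact H3|].
set (d := Cmod (y - w)) in *; set (K := (M * exp r)%R) in *.
assert (Hd : (0 <= d)%R) by apply Cmod_ge_0.
assert (d * (K + 1) <= eps)%R.
{ apply (Rmult_lt_compat_r (K + 1)) in H2; [|lra].
  replace (eps / (K + 1) * (K + 1))%R with eps in H2 by (field; lra); lra. }
nra.
Qed.

(** * The reciprocal Gamma function *)

Definition Gauss_quotient (z : C) (n : nat) : C :=
  rising z (S n) / (INR (fact n) * Cexp (z * ln (INR n))).

Lemma RtoC_INR_neq_0 (n : nat) : (n <> 0)%nat -> RtoC (INR n) <> 0.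
Proof. intros Hn H; apply RtoC_inj in H; apply (not_0_INR n Hn H). Qed.

Lemma filterlim_Cmod (u : nat -> C) (l : C) :
  filterlim u eventually (@locally C_UniformSpace l) ->
  is_lim_seq (fun n => Cmod (u n - l)) 0.
Proof.
intros H; apply is_lim_seq_spec; intros eps.
destruct (H (fun y => Cmod (y - l) < eps)%R) as [N HN].
- apply locally_C_Cmod; exists eps; split; [apply cond_pos|tauto].
- exists N; intros n Hn; rewrite Rminus_0_r, Rabs_right by apply Rle_ge, Cmod_ge_0.
  exact (HN n Hn).
Qed.

Lemma filterlim_eventually_shift (T : Type) (u : nat -> T) (k : nat) (F : (T -> Prop) -> Prop) :
  filterlim (fun n => u (n + k)%nat) eventually F -> filterlim u eventually F.
Proof.
intros H P HP; destruct (H P HP) as [N HN].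
exists (N + k)%nat; intros n Hn; replace n with ((n - k) + k)%nat by lia.
apply HN; lia.
Qed.

Lemma is_series_telescope_inv (N : nat) (c : R) : (1 <= N)%nat ->
  is_series (fun k => c / (INR (k + N) * INR (S (k + N))))%R (c / INR N)%R.
Proof.
intros HN.
assert (E : forall n, (c / INR N - c / INR (S (n + N)) =
   sum_n (fun k => c / (INR (k + N) * INR (S (k + N)))) n)%R).
{ induction n as [|n IH].
  - rewrite sum_O; simpl (0 + N)%nat; rewrite S_INR; field.
    split; [pose proof (pos_INR N); lra|apply not_0_INR; lia].
  - rewrite sum_Sn, <- IH; change (S n + N)%nat with (S (n + N)).
    unfold plus; simpl plus; cbn [AbelianMonoid.plus].
    rewrite (S_INR (S (n + N))), (S_INR (n + N)); simpl.
    pose proof (pos_INR (n + N)); field; repeat split; try lra; apply not_0_INR; lia. }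
apply (is_lim_seq_ext _ _ (Finite (c / INR N)) E).
replace (Finite (c / INR N)) with (Rbar_minus (c / INR N)%R (c * 0)%R)
  by (simpl; f_equal; ring).
apply is_lim_seq_minus'; [apply is_lim_seq_const|].
apply (is_lim_seq_scal_l (fun n => / INR (S (n + N)))%R c 0).
apply (is_lim_seq_incr_n (fun n => / INR (S n))%R N).
apply (is_lim_seq_incr_1 (fun n => / INR n)%R).
replace (Finite 0) with (Rbar_inv p_infty) by reflexivity.
apply is_lim_seq_inv; [apply is_lim_seq_INR|discriminate].
Qed.

(* The terms [u n] stay bounded because [Cmod (u n) * exp (K / n)] is nonincreasing. *)
Lemma ex_lim_product (u q : nat -> C) (N : nat) (K : R) : (1 <= N)%nat ->
  (forall n, (N <= n)%nat -> u (S n) = u n * q n) ->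
  (forall n, (N <= n)%nat -> (Cmod (q n - 1) <= K / (INR n * INR (S n)))%R) ->
  exists l : C, filterlim u eventually (@locally C_UniformSpace l).
Proof.
intros HN Hu Hq.
set (B := (Cmod (u N) * exp (K / INR N))%R).
assert (Hpos : forall n, (N <= n)%nat -> (0 < INR n)%R) by (intros n Hn; apply lt_0_INR; lia).
assert (HK : (0 <= K)%R).
{ pose proof (Hq N (le_n N)) as H; pose proof (Cmod_ge_0 (q N - 1)) as H'.
  assert (P : (0 < INR N * INR (S N))%R) by (apply Rmult_lt_0_compat; apply Hpos; lia).
  apply Rnot_lt_le; intros HK.
  assert (K / (INR N * INR (S N)) < 0)%R; [|lra].
  apply Rdiv_neg_pos; assumption. }
assert (HB : forall n, (N <= n)%nat -> (Cmod (u n) * exp (K / INR n) <= B)%R).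
{ intros n Hn; induction Hn as [|n Hn IH]; [apply Rle_refl|].
  eapply Rle_trans; [|exact IH].
  rewrite Hu by exact Hn; rewrite Cmod_mult, Rmult_assoc.
  apply Rmult_le_compat_l; [apply Cmod_ge_0|].
  replace (K / INR n)%R with (K / (INR n * INR (S n)) + K / INR (S n))%R.
  2:{ rewrite S_INR; pose proof (Hpos n Hn); field; lra. }
  rewrite exp_plus; apply Rmult_le_compat_r; [apply Rlt_le, exp_pos|].
  eapply Rle_trans; [|apply exp_ineq1_le].
  replace (q n) with (1 + (q n - 1)) by ring.
  eapply Rle_trans; [apply Cmod_triangle|]; rewrite Cmod_1.
  apply Rplus_le_compat_l, Hq, Hn. }
assert (Hb : forall n, (N <= n)%nat -> (Cmod (u n) <= B)%R).
{ intros n Hn; eapply Rle_trans; [|apply HB, Hn].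
  rewrite <- (Rmult_1_r (Cmod (u n))) at 1; apply Rmult_le_compat_l; [apply Cmod_ge_0|].
  rewrite <- exp_0; destruct (Rle_lt_or_eq_dec 0 (K / INR n)) as [h|h].
  - apply Rdiv_le_0_compat; [exact HK|apply Hpos, Hn].
  - apply Rlt_le, exp_increasing, h.
  - rewrite <- h; lra. }
(* Once [u] is bounded by [B], the increment u_n (q_n - 1) is at most BK/(n(n+1)). The telescoping
   series dominates it, so [u] converges as the sum of its increments. *)
destruct (ex_C_series_le (fun k => u (S (k + N)) - u (k + N)%nat)
  (fun k => (B * K) / (INR (k + N) * INR (S (k + N))))%R) as [l Hl].
- intros k; rewrite Hu by lia.
  replace (u (k + N)%nat * q (k + N)%nat - u (k + N)%nat)
    with (u (k + N)%nat * (q (k + N)%nat - 1)) by ring.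
  rewrite Cmod_mult; unfold Rdiv; rewrite Rmult_assoc.
  apply Rmult_le_compat; try apply Cmod_ge_0; [apply Hb|apply Hq]; lia.
- eexists; apply is_series_telescope_inv, HN.
- exists (l + u N).
  apply (filterlim_eventually_shift _ u (S N)).
  apply (filterlim_ext (fun n => @plus C_NormedModule
    (@sum_n C_AbelianGroup (fun k => u (S (k + N)) - u (k + N)%nat) n) (u N))).
  + intros n; rewrite <- Nat.add_succ_comm; change (S n + N)%nat with (S (n + N)).
    induction n as [|n IH].
    * rewrite sum_O; change (u (S N) - u N + u N = u (S N)); ring.
    * rewrite sum_Sn.
      transitivity ((u (S (S n + N)) - u (S n + N)%nat) + (@plus C_NormedModule
       (@sum_n C_AbelianGroup (fun k => u (S (k + N)) - u (k + N)%nat) n) (u N))).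
      -- unfold plus; simpl; ring.
      -- rewrite IH; simpl; ring.
  + eapply filterlim_comp_2; [exact Hl|apply filterlim_const|].
    exact (@filterlim_plus C_AbsRing C_NormedModule l (u N)).
Qed.

(** Both bounds are ln x <= x - 1, taken at x = (n+1)/n and at x = n/(n+1). *)
Lemma ln_succ_bounds (n : nat) : (1 <= n)%nat ->
  (- / INR n <= ln (INR n) - ln (INR (S n)) <= - / INR (S n))%R.
Proof.
intros Hn; assert (P : (0 < INR n)%R) by (apply lt_0_INR; lia).
assert (P' : (0 < INR (S n))%R) by (apply lt_0_INR; lia).
assert (L : forall x, (0 < x)%R -> (ln x <= x - 1)%R).
{ intros x Hx; pose proof (exp_ineq1_le (ln x)) as H; rewrite exp_ln in H by exact Hx; lra. }
split.
- pose proof (L (INR (S n) / INR n)%R ltac:(apply Rdiv_lt_0_compat; lra)) as H.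
  rewrite ln_div in H by assumption.
  replace (INR (S n) / INR n - 1)%R with (/ INR n)%R in H by (rewrite S_INR; field; lra).
  lra.
- pose proof (L (INR n / INR (S n))%R ltac:(apply Rdiv_lt_0_compat; lra)) as H.
  rewrite ln_div in H by assumption.
  replace (INR n / INR (S n) - 1)%R with (- / INR (S n))%R in H
    by (rewrite S_INR in *; field; lra).
  lra.
Qed.

Lemma rising_shift (z : C) (n : nat) : rising z (S n) = z * rising (z + 1) n.
Proof.
induction n as [|n IH]; [simpl; ring|].
change (rising z (S (S n))) with (rising z (S n) * (z + INR (S n))).
rewrite IH, S_INR, RtoC_plus; simpl; ring.
Qed.

(** Valid at n = 0 too: the default value of [ln 0] cancels between the quotient and the factor. *)
Lemma Gauss_quotient_S (z : C) (n : nat) :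
  Gauss_quotient z (S n) = Gauss_quotient z n *
    ((1 + z * RtoC (/ INR (S n))) * Cexp (z * RtoC (ln (INR n) - ln (INR (S n))))).
Proof.
unfold Gauss_quotient.
change (rising z (S (S n))) with (rising z (S n) * (z + INR (S n))).
replace (Cexp (z * ln (INR n)))
  with (Cexp (z * ln (INR (S n))) * Cexp (z * RtoC (ln (INR n) - ln (INR (S n))))).
2:{ rewrite <- Cexp_plus; f_equal; rewrite RtoC_minus; ring. }
rewrite fact_simpl, mult_INR, RtoC_mult, RtoC_inv by (apply not_0_INR; lia).
field; repeat split; try apply Cexp_neq_0; apply RtoC_INR_neq_0; [lia|apply fact_neq_0].
Qed.

(** The first-order parts z/(n+1) and z ln(n/(n+1)) cancel up to |z|/(n(n+1)); everything else is
    quadratic in z. The condition on [n] keeps the exponent within the range of [Cexp_taylor2]. *)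
Lemma Gauss_factor_bound (z : C) (n : nat) : (1 <= n)%nat -> (2 * Cmod z <= INR n)%R ->
  (Cmod ((1 + z * RtoC (/ INR (S n))) * Cexp (z * RtoC (ln (INR n) - ln (INR (S n)))) - 1)
   <= (Cmod z + 10 * (Cmod z * Cmod z)) / (INR n * INR (S n)))%R.
Proof.
intros Hn Hz.
assert (P : (0 < INR n)%R) by (apply lt_0_INR; lia).
pose proof (ln_succ_bounds n Hn) as Hl.
set (t := (ln (INR n) - ln (INR (S n)))%R) in *.
set (d := (/ INR (S n))%R) in *.
assert (Hd : (0 < d)%R) by (apply Rinv_0_lt_compat, lt_0_INR; lia).
set (e := (/ INR n)%R) in *.
assert (He : (0 < e)%R) by (apply Rinv_0_lt_compat; exact P).
assert (Ed : (e - d = e * d)%R).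
{ unfold e, d; rewrite S_INR; field; lra. }
assert (Hed : (e <= 2 * d)%R).
{ assert (e <= 1)%R; [|nra].
  unfold e; rewrite <- Rinv_1; apply Rinv_le_contravar; [lra|].
  change 1%R with (INR 1); apply le_INR, Hn. }
pose proof (Cmod_ge_0 z) as Hz0.
assert (Hze : (Cmod z * e <= 1/2)%R).
{ apply Rmult_le_reg_r with (INR n); [exact P|].
  unfold e; rewrite Rmult_assoc, Rinv_l by lra; lra. }
assert (At : (Rabs t <= e)%R) by (apply Rabs_le; lra).
set (h := z * RtoC t).
assert (Hh : (Cmod h <= Cmod z * e)%R).
{ unfold h; rewrite Cmod_mult, Cmod_R; apply Rmult_le_compat_l; assumption. }
pose proof (Cexp_taylor2 h ltac:(lra)) as HT; pose proof (Cmod_ge_0 h) as Hh0.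
set (rho := Cexp h - 1 - h) in *.
(* The three pieces are bounded by |z|ed, |z|^2 ed and (3/2) 3 |z|^2 e^2. As e <= 2d, the last is at
   most 9|z|^2 ed, whence the constant 10 = 1 + 9. *)
replace ((1 + z * RtoC d) * Cexp h - 1)
  with (z * RtoC (d + t) + (z * RtoC d * h + (1 + z * RtoC d) * rho))
  by (unfold rho, h; rewrite RtoC_plus; ring).
replace ((Cmod z + 10 * (Cmod z * Cmod z)) / (INR n * INR (S n)))%R
  with ((Cmod z + 10 * (Cmod z * Cmod z)) * (e * d))%R
  by (unfold e, d; rewrite S_INR; field; lra).
eapply Rle_trans; [apply Cmod_triangle|].
assert (B1 : (Cmod (z * RtoC (d + t)) <= Cmod z * (e * d))%R).
{ rewrite Cmod_mult, Cmod_R; apply Rmult_le_compat_l; [exact Hz0|]; apply Rabs_le; lra. }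
assert (B2 : (Cmod (z * RtoC d * h) <= Cmod z * d * (Cmod z * e))%R).
{ rewrite !Cmod_mult, Cmod_R, (Rabs_right d) by lra.
  apply Rmult_le_compat_l; [nra|exact Hh]. }
assert (B3 : (Cmod ((1 + z * RtoC d) * rho) <= 3/2 * (3 * ((Cmod z * e) * (Cmod z * e))))%R).
{ rewrite Cmod_mult; apply Rmult_le_compat; try apply Cmod_ge_0.
  - eapply Rle_trans; [apply Cmod_triangle|]; rewrite Cmod_1, Cmod_mult, Cmod_R, Rabs_right by lra.
    nra.
  - eapply Rle_trans; [exact HT|]; nra. }
pose proof (Cmod_triangle (z * RtoC d * h) ((1 + z * RtoC d) * rho)) as B4.
assert (B5 : ((Cmod z * e) * (Cmod z * e) <= 2 * (Cmod z * Cmod z * (e * d)))%R).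
{ replace ((Cmod z * e) * (Cmod z * e))%R with (Cmod z * Cmod z * e * e)%R by ring.
  replace (2 * (Cmod z * Cmod z * (e * d)))%R with (Cmod z * Cmod z * e * (2 * d))%R by ring.
  apply Rmult_le_compat_l; [|exact Hed]; repeat apply Rmult_le_pos; lra. }
lra.
Qed.

Lemma ex_nat_ge (x : R) : exists N : nat, (1 <= N)%nat /\ (x <= INR N)%R.
Proof.
destruct (INR_unbounded x) as [N HN]; exists (S N); split; [lia|]; rewrite S_INR; lra.
Qed.

Lemma is_lim_rGamma (z : C) :
  filterlim (Gauss_quotient z) eventually (@locally C_UniformSpace (C_rGamma z)).
Proof.
destruct (ex_nat_ge (2 * Cmod z)) as [N [HN1 HN]].
destruct (ex_lim_product (Gauss_quotient z)
  (fun n => (1 + z * RtoC (/ INR (S n))) * Cexp (z * RtoC (ln (INR n) - ln (INR (S n)))))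
  N (Cmod z + 10 * (Cmod z * Cmod z)) HN1) as [l Hl].
- intros n _; apply Gauss_quotient_S.
- intros n Hn; apply Gauss_factor_bound; [lia|].
  eapply Rle_trans; [exact HN|apply le_INR, Hn].
- unfold C_rGamma; fold (Gauss_quotient z); rewrite (is_C_lim_seq_unique _ l Hl); exact Hl.
Qed.

(** The functional equation before the limit: the shifted rising factorial gains the factor z + n +
    1 and the power of n gains n, and their ratio 1 + (z+1)/n tends to 1. *)
Lemma Gauss_quotient_shift (z : C) (n : nat) : (1 <= n)%nat ->
  z * Gauss_quotient (z + 1) n = Gauss_quotient z n * (1 + (z + 1) * RtoC (/ INR n)).
Proof.
intros Hn; unfold Gauss_quotient.
replace (Cexp ((z + 1) * ln (INR n))) with (Cexp (z * ln (INR n)) * RtoC (INR n)).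
2:{ replace ((z + 1) * ln (INR n)) with (z * ln (INR n) + ln (INR n)) by ring.
    rewrite Cexp_plus; f_equal; unfold Cexp, RtoC; cbn [Re Im fst snd].
    rewrite cos_0, sin_0, exp_ln by (apply lt_0_INR; lia); f_equal; ring. }
assert (E : z * rising (z + 1) (S n) = rising z (S n) * (z + INR n + 1)).
{ rewrite <- rising_shift.
  change (rising z (S (S n))) with (rising z (S n) * (z + INR (S n))).
  rewrite S_INR, RtoC_plus; ring. }
rewrite RtoC_inv by (apply not_0_INR; lia).
unfold Cdiv; rewrite Cmult_assoc, E.
field; repeat split; try apply Cexp_neq_0; apply RtoC_INR_neq_0; [lia|apply fact_neq_0].
Qed.

Lemma rGamma_recurrence (z : C) : C_rGamma z = z * C_rGamma (z + 1).
Proof.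
set (A := C_rGamma z); set (B := C_rGamma (z + 1)).
pose proof (filterlim_Cmod _ _ (is_lim_rGamma z)) as Ha.
pose proof (filterlim_Cmod _ _ (is_lim_rGamma (z + 1))) as Hb.
fold A in Ha; fold B in Hb.
set (m := Cmod (z + 1)).
assert (Hinv : is_lim_seq (fun n => / INR n)%R 0).
{ replace (Finite 0) with (Rbar_inv p_infty) by reflexivity.
  apply is_lim_seq_inv; [apply is_lim_seq_INR|discriminate]. }
assert (H : (Cmod (z * B - A) <= 0)%R).
{ apply (is_lim_seq_le_loc (fun _ => Cmod (z * B - A))
   (fun n => Cmod z * Cmod (Gauss_quotient (z + 1) n - B)
     + (Cmod (Gauss_quotient z n - A) * (1 + m * / INR n) + Cmod A * (m * / INR n)))%R
   (Cmod (z * B - A)) 0).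
  - exists 1%nat; intros n Hn.
    replace (z * B - A) with (- (z * (Gauss_quotient (z + 1) n - B))
      + ((Gauss_quotient z n - A) * (1 + (z + 1) * RtoC (/ INR n)) + A * ((z + 1) * RtoC (/ INR n)))).
    2:{ transitivity (z * B - A - z * Gauss_quotient (z + 1) n
          + Gauss_quotient z n * (1 + (z + 1) * RtoC (/ INR n))); [ring|].
        rewrite <- (Gauss_quotient_shift z n Hn); ring. }
    assert (Hi : (0 < / INR n)%R) by (apply Rinv_0_lt_compat, lt_0_INR; lia).
    eapply Rle_trans; [apply Cmod_triangle|].
    rewrite Cmod_opp, Cmod_mult; apply Rplus_le_compat_l.
    eapply Rle_trans; [apply Cmod_triangle|].
    rewrite !Cmod_mult, Cmod_R, (Rabs_right (/ INR n)) by lra; fold m.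
    apply Rplus_le_compat_r, Rmult_le_compat_l; [apply Cmod_ge_0|].
    eapply Rle_trans; [apply Cmod_triangle|].
    rewrite Cmod_1, Cmod_mult, Cmod_R, (Rabs_right (/ INR n)) by lra; fold m; lra.
  - apply is_lim_seq_const.
  - replace (Finite 0) with (Finite (Cmod z * 0 + (0 * (1 + m * 0) + Cmod A * (m * 0)))%R)
      by (f_equal; ring).
    apply is_lim_seq_plus'; [apply (is_lim_seq_scal_l _ (Cmod z) 0 Hb)|].
    assert (Hm := is_lim_seq_scal_l _ m 0 Hinv).
    apply is_lim_seq_plus'; [|apply (is_lim_seq_scal_l _ (Cmod A) (m * 0)%R Hm)].
    apply is_lim_seq_mult'; [exact Ha|].
    apply is_lim_seq_plus'; [apply is_lim_seq_const|exact Hm]. }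
symmetry; assert (E : z * B - A = 0) by (apply Cmod_eq_0; pose proof (Cmod_ge_0 (z * B - A)); lra).
replace (z * B) with ((z * B - A) + A) by ring; rewrite E; ring.
Qed.

(** At 0 the recurrence has the factor 0; from there the zero propagates downwards. *)
Lemma rGamma_nonpos (n : nat) : C_rGamma (- RtoC (INR n)) = 0.
Proof.
induction n as [|n IH].
- rewrite rGamma_recurrence; simpl; ring.
- rewrite rGamma_recurrence.
  replace (- RtoC (INR (S n)) + 1) with (- RtoC (INR n)) by (rewrite S_INR, RtoC_plus; ring).
  rewrite IH; ring.
Qed.

(** As soon as |z + s| >= 1, the recurrence makes |1/Gamma(z + s)| nonincreasing in [s]; the
    finitely many earlier values are covered by a maximum. *)
Lemma rGamma_bounded (z : C) : exists M : R, forall s : nat, (Cmod (C_rGamma (z + INR s)) <= M)%R.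
Proof.
destruct (ex_nat_ge (Cmod z + 1)) as [N [_ HN]].
assert (F : forall k, exists M, forall s, (s <= k)%nat -> (Cmod (C_rGamma (z + INR s)) <= M)%R).
{ induction k as [|k [M HM]].
  - exists (Cmod (C_rGamma (z + INR 0))); intros s Hs; replace s with 0%nat by lia; lra.
  - exists (Rmax M (Cmod (C_rGamma (z + INR (S k))))); intros s Hs.
    destruct (Nat.eq_dec s (S k)) as [->|h]; [apply Rmax_r|].
    eapply Rle_trans; [apply HM; lia|apply Rmax_l]. }
destruct (F N) as [M HM]; exists M; intros s.
destruct (Nat.le_gt_cases s N) as [h|h]; [apply HM, h|].
apply Rle_trans with (Cmod (C_rGamma (z + INR N))); [|apply HM; lia].
assert (h' : (N <= s)%nat) by lia; clear h; induction h' as [|s hs IH]; [apply Rle_refl|].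
eapply Rle_trans; [|exact IH].
rewrite (rGamma_recurrence (z + INR s)), Cmod_mult.
replace (z + INR s + 1) with (z + INR (S s)) by (rewrite S_INR, RtoC_plus; ring).
assert (1 <= Cmod (z + INR s))%R.
{ pose proof (Cmod_triangle (z + INR s) (- z)) as T; rewrite Cmod_opp in T.
  replace (z + INR s + - z) with (RtoC (INR s)) in T by ring.
  rewrite Cmod_R, Rabs_right in T by apply Rle_ge, pos_INR.
  apply le_INR in hs; lra. }
pose proof (Cmod_ge_0 (C_rGamma (z + INR (S s)))); nra.
Qed.

(** * Bessel functions of a complex variable *)

(** The coefficients of F_nu, so that F_nu is [entire (Bessel_coef nu)], a series in the variable
    (z/2)^2. *)
Definition Bessel_coef (nu : C) (s : nat) : C :=
  RtoC ((-1) ^ s / INR (fact s))%R * C_rGamma (nu + INR s + 1).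

Definition Bessel_term (L : C -> C) (nu z : C) (s : nat) : C :=
  Bessel_coef nu s * Cpower L (z / 2) (nu + RtoC (2 * INR s)%R).

Definition C_BesselJ (L : C -> C) (nu z : C) : C := C_Series (Bessel_term L nu z).

Lemma Bessel_coef_bounded (nu : C) : exists M : R, exp_bounded M (Bessel_coef nu).
Proof.
destruct (rGamma_bounded (nu + 1)) as [M HM]; exists M; intros n.
unfold Bessel_coef; rewrite Cmod_mult, Cmod_R.
replace (nu + INR n + 1) with (nu + 1 + INR n) by ring.
pose proof (INR_fact_lt_0 n) as P.
unfold Rdiv; rewrite Rabs_mult, pow_1_abs, Rmult_1_l, Rabs_right
  by (apply Rle_ge, Rlt_le, Rinv_0_lt_compat, P).
rewrite Rmult_comm; apply Rmult_le_compat_r; [apply Rlt_le, Rinv_0_lt_compat, P|apply HM].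
Qed.

Lemma deriv_Bessel_coef (nu : C) (s : nat) :
  deriv_coef (Bessel_coef nu) s = - Bessel_coef (nu + 1) s.
Proof.
unfold deriv_coef, Bessel_coef.
replace (nu + INR (S s) + 1) with (nu + 1 + INR s + 1) by (rewrite S_INR, RtoC_plus; ring).
rewrite Cmult_assoc, <- RtoC_mult.
replace (INR (S s) * ((-1) ^ S s / INR (fact (S s))))%R with (- ((-1) ^ s / INR (fact s)))%R.
- rewrite RtoC_opp; ring.
- rewrite fact_simpl, mult_INR; simpl pow; field.
  split; [apply INR_fact_neq_0|apply not_0_INR; lia].
Qed.

Lemma Bessel_coef_pred (nu : C) (s : nat) :
  Bessel_coef (nu - 1) s = (nu + INR s) * Bessel_coef nu s.
Proof.
unfold Bessel_coef.
replace (nu - 1 + INR s + 1) with (nu + INR s) by ring.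
rewrite (rGamma_recurrence (nu + INR s)); ring.
Qed.

Lemma entire_ext (a b : nat -> C) (w : C) : (forall n, a n = b n) -> entire a w = entire b w.
Proof.
intros H; unfold entire, C_Series, C_Lim_seq; f_equal; f_equal; apply Lim_seq_ext;
  intros n; f_equal; apply sum_n_ext; intros k; rewrite H; reflexivity.
Qed.

Lemma entire_scal (M : R) (a : nat -> C) (c w : C) : exp_bounded M a ->
  entire (fun n => c * a n) w = c * entire a w.
Proof.
intros H; apply is_C_series_unique.
apply (is_C_series_ext (fun n => c * (a n * w ^ n)));
  [intros n; ring|].
apply (@is_series_scal C_AbsRing C_NormedModule c), is_series_entire with M, H.
Qed.

Lemma is_derive_Bessel_entire (nu w : C) :
  @is_derive C_AbsRing C_NormedModule (entire (Bessel_coef nu)) w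
    (- entire (Bessel_coef (nu + 1)) w).
Proof.
destruct (Bessel_coef_bounded nu) as [M HM].
destruct (Bessel_coef_bounded (nu + 1)) as [M' HM'].
replace (- entire (Bessel_coef (nu + 1)) w) with (entire (deriv_coef (Bessel_coef nu)) w);
  [apply is_derive_entire with M, HM|].
rewrite (entire_ext _ (fun n => (- (1)) * Bessel_coef (nu + 1) n)).
- rewrite (entire_scal _ _ _ _ HM'); ring.
- intros n; rewrite deriv_Bessel_coef; ring.
Qed.

(** By [Bessel_coef_pred] the coefficients are multiplied by nu + s. The part nu gives nu F_nu; the
    part s gives w F_nu'(w), that is, -w F_(nu+1)(w). *)
Lemma entire_Bessel_pred (nu w : C) :
  entire (Bessel_coef (nu - 1)) w =
  nu * entire (Bessel_coef nu) w - w * entire (Bessel_coef (nu + 1)) w.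
Proof.
destruct (Bessel_coef_bounded nu) as [M HM].
destruct (Bessel_coef_bounded (nu + 1)) as [M' HM'].
apply is_C_series_unique.
set (u := fun n => match n with O => RtoC 0 | S m => w * (Bessel_coef (nu + 1) m * w ^ m) end).
apply (is_C_series_ext
  (fun n => nu * (Bessel_coef nu n * w ^ n) - u n)).
- intros [|n]; rewrite Bessel_coef_pred; unfold u.
  + simpl; ring.
  + transitivity ((nu + RtoC (INR (S n))) * Bessel_coef nu (S n) * w ^ S n); [|reflexivity].
    pose proof (deriv_Bessel_coef nu n) as E; unfold deriv_coef in E.
    replace (Bessel_coef (nu + 1) n) with (- (RtoC (INR (S n)) * Bessel_coef nu (S n)))
      by (rewrite E; ring).
    rewrite Cpow_S; ring.
- apply (@is_series_minus C_AbsRing C_NormedModule).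
  + apply (@is_series_scal C_AbsRing C_NormedModule nu), is_series_entire with M, HM.
  + apply (@is_series_decr_1 C_AbsRing C_NormedModule).
    match goal with |- is_series _ ?l =>
      replace l with (w * entire (Bessel_coef (nu + 1)) w) end.
    2:{ change (w * entire (Bessel_coef (nu + 1)) w
                = w * entire (Bessel_coef (nu + 1)) w + - 0); ring. }
    apply (@is_series_scal C_AbsRing C_NormedModule w), is_series_entire with M', HM'.
Qed.

(** * Complex powers and convergence of the Bessel series *)

Lemma Cexp_INR (z : C) (n : nat) : Cexp (RtoC (INR n) * z) = Cexp z ^ n.
Proof.
induction n as [|n IH].
- replace (RtoC (INR 0) * z) with (RtoC 0) by (simpl; ring); rewrite Cexp_0; reflexivity.
- rewrite S_INR, RtoC_plus, Cpow_S, <- IH, <- Cexp_plus; f_equal; ring.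
Qed.

Lemma Cpower_neq_0 (L : C -> C) (u nu : C) : u <> 0 -> Cpower L u nu = Cexp (nu * L u).
Proof. intros H; unfold Cpower; destruct (Ceq_dec u 0); [contradiction|reflexivity]. Qed.

Lemma Cpower_plus_INR (L : C -> C) (u nu : C) (n : nat) : u <> 0 -> Cexp (L u) = u ->
  Cpower L u (nu + RtoC (INR n)) = Cpower L u nu * u ^ n.
Proof.
intros Hu HL; rewrite !Cpower_neq_0 by exact Hu.
rewrite Cmult_plus_distr_r, Cexp_plus, Cexp_INR, HL; reflexivity.
Qed.

(** The convention of [Cpower] at 0 agrees with natural powers, including 0^0 = 1. This lets integer
    orders be treated uniformly across 0. *)
Lemma Cpower_INR (L : C -> C) (u : C) (n : nat) : (u = 0 \/ Cexp (L u) = u) ->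
  Cpower L u (RtoC (INR n)) = u ^ n.
Proof.
intros H; destruct (Ceq_dec u 0) as [->|Hu].
- unfold Cpower; destruct (Ceq_dec 0 0) as [_|h]; [|contradict h; reflexivity].
  destruct n as [|n].
  + simpl; destruct (Ceq_dec 0 0) as [_|h]; [reflexivity|contradict h; reflexivity].
  + destruct (Ceq_dec (RtoC (INR (S n))) 0) as [h|_];
      [exfalso; revert h; apply RtoC_INR_neq_0; lia|].
    rewrite Cpow_S; ring.
- destruct H as [H|H]; [contradiction|].
  replace (RtoC (INR n)) with (0 + RtoC (INR n)) by ring.
  rewrite Cpower_plus_INR, Cpower_neq_0 by assumption.
  replace (0 * L u) with (RtoC 0) by ring; rewrite Cexp_0; ring.
Qed.

Lemma is_series_Bessel (L : C -> C) (nu z : C) : z / 2 <> 0 -> Cexp (L (z / 2)) = z / 2 ->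
  @is_series C_AbsRing C_NormedModule (Bessel_term L nu z)
    (Cpower L (z / 2) nu * entire (Bessel_coef nu) (z / 2 * (z / 2))).
Proof.
intros Hu HL; destruct (Bessel_coef_bounded nu) as [M HM].
apply (is_C_series_ext
  (fun s => Cpower L (z / 2) nu * (Bessel_coef nu s * (z / 2 * (z / 2)) ^ s))).
- intros s; unfold Bessel_term.
  replace (2 * INR s)%R with (INR (2 * s)) by (rewrite mult_INR; reflexivity).
  rewrite Cpower_plus_INR by assumption.
  replace (z / 2 * (z / 2)) with ((z / 2) ^ 2) by (simpl; ring).
  rewrite Cpow_mult_r; ring.
- apply (@is_series_scal C_AbsRing C_NormedModule (Cpower L (z / 2) nu)),
    is_series_entire with M, HM.
Qed.

Lemma is_series_finite (a : nat -> C) (N : nat) : (forall n, (N < n)%nat -> a n = 0) ->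
  @ex_series C_AbsRing C_NormedModule a.
Proof.
intros H; exists (@sum_n C_AbelianGroup a N).
apply (filterlim_eventually_shift _ _ N).
apply (filterlim_ext (fun _ => @sum_n C_AbelianGroup a N)); [|apply filterlim_const].
induction x as [|n IH]; [reflexivity|].
change (S n + N)%nat with (S (n + N)); rewrite sum_Sn, <- IH, H by lia.
symmetry; apply (@plus_zero_r C_AbelianGroup).
Qed.

(** At 0 a power is nonzero only if nu + 2s = 0, which forces 2s = |nu|; the series is then a finite
    sum, for every [nu]. *)
Lemma is_series_C_BesselJ (L : C -> C) (nu z : C) : (z / 2 = 0 \/ Cexp (L (z / 2)) = z / 2) ->
  @is_series C_AbsRing C_NormedModule (Bessel_term L nu z) (C_BesselJ L nu z).
Proof.
intros H; apply is_C_series_ex; destruct (Ceq_dec (z / 2) 0) as [h|h].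
- destruct (ex_nat_ge (Cmod nu)) as [N [HN1 HN]].
  apply is_series_finite with N; intros n Hn.
  unfold Bessel_term, Cpower; rewrite h.
  destruct (Ceq_dec 0 0) as [_|e]; [|contradict e; reflexivity].
  destruct (Ceq_dec (nu + RtoC (2 * INR n)) 0) as [e|_]; [exfalso|ring].
  replace nu with (- RtoC (2 * INR n)) in HN.
  + rewrite Cmod_opp, Cmod_R, Rabs_right in HN by (pose proof (pos_INR n); lra).
    apply lt_INR in Hn; pose proof (pos_INR N); lra.
  + transitivity (nu - (nu + RtoC (2 * INR n))); [ring|rewrite e; ring].
- destruct H as [H|H]; [contradiction|].
  eexists; apply is_series_Bessel; assumption.
Qed.

Lemma C_BesselJ_eq (L : C -> C) (nu z : C) : z / 2 <> 0 -> Cexp (L (z / 2)) = z / 2 ->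
  C_BesselJ L nu z = Cpower L (z / 2) nu * entire (Bessel_coef nu) (z / 2 * (z / 2)).
Proof. intros Hu HL; apply is_C_series_unique, is_series_Bessel; assumption. Qed.

Lemma half_0 : RtoC 0 / 2 = 0.
Proof. unfold Cdiv; ring. Qed.

Lemma half_neq_0 (z : C) : z <> 0 -> z / 2 <> 0.
Proof.
intros Hz H; apply Hz; replace z with (z / 2 * 2) by (field; exact C2_neq_0).
rewrite H; ring.
Qed.

Lemma C_series_zero (a : nat -> C) : (forall n, a n = 0) ->
  @is_series C_AbsRing C_NormedModule a (RtoC 0).
Proof.
intros H; apply (filterlim_ext (fun _ => RtoC 0)); [|apply filterlim_const].
induction x as [|n IH]; [rewrite sum_O, H; reflexivity|].
rewrite sum_Sn, <- IH, H; symmetry; apply (@plus_zero_r C_AbelianGroup).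
Qed.

(* The only term that survives at 0 has [nu = - 2 s]; if [s > 0] then
   [nu + s + 1 = 1 - s] is a pole of Gamma and its coefficient vanishes. *)
Lemma mult_C_BesselJ_0 (L : C -> C) (nu : C) : nu * C_BesselJ L nu 0 = 0.
Proof.
pose proof (is_series_C_BesselJ L nu 0 (or_introl half_0)) as H.
apply (@is_series_scal C_AbsRing C_NormedModule nu) in H.
transitivity (C_Series (fun s => nu * Bessel_term L nu 0 s));
  [symmetry; apply is_C_series_unique; exact H|].
apply is_C_series_unique, C_series_zero; intros s; unfold Bessel_term, Cpower; rewrite half_0.
destruct (Ceq_dec 0 0) as [_|h]; [|contradict h; reflexivity].
destruct (Ceq_dec (nu + RtoC (2 * INR s)) 0) as [e|_]; [|ring].
assert (E : nu = - RtoC (2 * INR s))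
  by (transitivity (nu + RtoC (2 * INR s) - RtoC (2 * INR s)); [ring|rewrite e; ring]).
destruct s as [|s]; [rewrite E; simpl; rewrite Rmult_0_r; ring|].
unfold Bessel_coef.
replace (nu + INR (S s) + 1) with (- RtoC (INR s)); [rewrite rGamma_nonpos; ring|].
rewrite E, S_INR, RtoC_mult, RtoC_plus; ring.
Qed.

Lemma C_BesselJ_0 (L : C -> C) (nu : C) : (0 < Re nu)%R -> C_BesselJ L nu 0 = 0.
Proof.
intros H; apply is_C_series_unique, C_series_zero; intros s.
unfold Bessel_term, Cpower; rewrite half_0.
destruct (Ceq_dec 0 0) as [_|h]; [|contradict h; reflexivity].
destruct (Ceq_dec (nu + RtoC (2 * INR s)) 0) as [e|_]; [exfalso|ring].
apply (f_equal fst) in e; unfold Re in H; pose proof (pos_INR s).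
unfold Cplus, RtoC in e; simpl in e; lra.
Qed.

Lemma is_C_derive_half (z : C) :
  @is_derive C_AbsRing C_NormedModule (fun y => y / 2) z (/ 2).
Proof.
apply is_C_derive_eps; intros eps Heps; exists 1%R; split; [lra|]; intros y _.
replace (y / 2 - z / 2 - (y - z) * / 2) with (RtoC 0) by (unfold Cdiv; ring).
rewrite Cmod_0; apply Rmult_le_pos; [lra|apply Cmod_ge_0].
Qed.

Lemma is_C_derive_half_sqr (z : C) :
  @is_derive C_AbsRing C_NormedModule (fun y => y / 2 * (y / 2)) z (z / 2).
Proof.
replace (z / 2) with (/ 2 * (z / 2) + z / 2 * / 2) by (field; exact C2_neq_0).
apply (is_C_derive_mult (fun y => y / 2) (fun y => y / 2)); apply is_C_derive_half.
Qed.

(** Differentiating exp(L(w)) = w near [u] and comparing with the derivative of the identity gives u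
    L'(u) = 1. *)
Lemma is_C_derive_branch (L : C -> C) (u : C) : log_near L u ->
  exists l : C, @is_derive C_AbsRing C_NormedModule L u l /\ u * l = 1.
Proof.
intros H; destruct (locally_singleton u _ H) as [HL [l Hl]].
exists l; split; [exact Hl|].
pose proof (is_C_derive_comp Cexp L u _ l (is_derive_Cexp (L u)) Hl) as D1.
assert (D2 : @is_derive C_AbsRing C_NormedModule (fun y => y) u (RtoC 1)).
{ apply is_C_derive_AbsRing, (@is_derive_id C_AbsRing). }
rewrite HL in D1.
transitivity (C_derive (fun y => y) u); [symmetry|apply is_C_derive_unique, D2].
rewrite Cmult_comm; apply is_C_derive_unique.
apply (is_derive_ext_loc (fun y => Cexp (L y))); [|exact D1].
apply (locally_C u (fun t => Cexp (L t) = t)).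
unfold log_near in H; revert H; apply filter_imp; tauto.
Qed.

(** One [D] serves both identities, so that a single bicomplex derivative can be assembled from the
    two components. *)
Definition Bessel_identities (L : C -> C) (nu z : C) : Prop :=
  exists D : C, @is_derive C_AbsRing C_NormedModule (C_BesselJ L nu) z D /\
    z * D + nu * C_BesselJ L nu z = z * C_BesselJ L (nu - 1) z /\
    z * D + z * C_BesselJ L (nu + 1) z = nu * C_BesselJ L nu z.

Lemma Bessel_identities_neq_0 (L : C -> C) (nu z : C) :
  z <> 0 -> log_near L (z / 2) -> Bessel_identities L nu z.
Proof.
intros Hz HL; pose proof (half_neq_0 z Hz) as Hu.
destruct (locally_singleton _ _ HL) as [Hgood _].
destruct (is_C_derive_branch L (z / 2) HL) as [l [Dl El]].
set (u := z / 2) in *.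
assert (Ez : z = 2 * u) by (unfold u; field; exact C2_neq_0).
set (p := Cexp (nu * L u)).
(* Product rule for u^nu F_nu(u^2) with u = z/2: [/ 2 * l * nu * p] is the z-derivative of u^nu, and
   u that of u^2. *)
exists (/ 2 * l * nu * p * entire (Bessel_coef nu) (u * u)
        - p * u * entire (Bessel_coef (nu + 1)) (u * u)).
assert (E0 : C_BesselJ L nu z = p * entire (Bessel_coef nu) (u * u)).
{ rewrite C_BesselJ_eq by assumption; fold u; rewrite Cpower_neq_0 by exact Hu; reflexivity. }
assert (E1 : C_BesselJ L (nu + 1) z = u * p * entire (Bessel_coef (nu + 1)) (u * u)).
{ rewrite C_BesselJ_eq by assumption; fold u.
  change (nu + 1) with (nu + RtoC (INR 1)) at 1.
  rewrite Cpower_plus_INR, Cpower_neq_0 by assumption; fold p; rewrite Cpow_1_r; ring. }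
(* Multiplying by u turns u^(nu-1) into u^nu = p, so that all three orders share one power. *)
assert (E2 : u * C_BesselJ L (nu - 1) z = p * entire (Bessel_coef (nu - 1)) (u * u)).
{ rewrite C_BesselJ_eq by assumption; fold u.
  transitivity (Cpower L u ((nu - 1) + RtoC (INR 1)) * entire (Bessel_coef (nu - 1)) (u * u)).
  - rewrite Cpower_plus_INR, Cpow_1_r by assumption; ring.
  - rewrite Cpower_neq_0 by exact Hu; unfold p; do 3 f_equal; simpl; ring. }
rewrite entire_Bessel_pred in E2.
split; [|split].
- apply (is_derive_ext_loc (fun y =>
    Cexp (nu * L (y / 2)) * entire (Bessel_coef nu) (y / 2 * (y / 2)))).
  + destruct (proj1 (locally_C_Cmod _ _) HL) as [d [Hd Hy]].
    assert (Hm : (0 < Cmod z)%R) by (apply Cmod_gt_0, Hz).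
    apply (locally_C z (fun t => _ = C_BesselJ L nu t)), locally_C_Cmod.
    (* The radius [Cmod z] keeps y away from 0; [d] keeps y/2 where the branch is valid. *)
    exists (Rmin (Cmod z) d); split; [apply Rmin_pos; assumption|].
    intros y Hyd.
    assert (H1 := Rlt_le_trans _ _ _ Hyd (Rmin_l _ _)).
    assert (H2 := Rlt_le_trans _ _ _ Hyd (Rmin_r _ _)).
    assert (Hy0 : y <> 0).
    { intros ->; replace (0 - z) with (- z) in H1 by ring; rewrite Cmod_opp in H1; lra. }
    rewrite C_BesselJ_eq, Cpower_neq_0; try reflexivity; try apply half_neq_0, Hy0.
    apply Hy; unfold u; replace (y / 2 - z / 2) with ((y - z) * RtoC (/ 2))
      by (rewrite RtoC_inv by lra; unfold Cdiv; ring).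
    rewrite Cmod_mult, Cmod_R, Rabs_right by lra.
    pose proof (Cmod_ge_0 (y - z)); lra.
  + replace (/ 2 * l * nu * p * entire (Bessel_coef nu) (u * u)
        - p * u * entire (Bessel_coef (nu + 1)) (u * u))
      with ((/ 2 * (l * nu) * p) * entire (Bessel_coef nu) (z / 2 * (z / 2))
        + p * (z / 2 * (- entire (Bessel_coef (nu + 1)) (z / 2 * (z / 2)))))
      by (fold u; ring).
    apply (is_C_derive_mult (fun y => Cexp (nu * L (y / 2)))
      (fun y => entire (Bessel_coef nu) (y / 2 * (y / 2)))).
    * replace (/ 2 * (l * nu) * p) with (/ 2 * ((l * nu) * p)) by ring.
      apply (is_C_derive_comp (fun w => Cexp (nu * L w)) (fun y => y / 2));
        [|apply is_C_derive_half].
      apply (is_C_derive_comp Cexp (fun w => nu * L w)); [apply is_derive_Cexp|].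
      replace (l * nu) with (0 * L u + nu * l) by ring.
      apply (is_C_derive_mult (fun _ => nu) L); [|exact Dl].
      apply (@is_derive_const C_AbsRing C_NormedModule nu).
    * apply (is_C_derive_comp (entire (Bessel_coef nu)) (fun y => y / 2 * (y / 2)));
        [apply is_derive_Bessel_entire|apply is_C_derive_half_sqr].
- rewrite E0; transitivity (2 * (u * C_BesselJ L (nu - 1) z)); [|rewrite Ez; ring].
  rewrite E2, Ez.
  transitivity ((u * l) * nu * p * entire (Bessel_coef nu) (u * u) * (2 * / 2)
   + nu * (p * entire (Bessel_coef nu) (u * u))
   - 2 * u * (p * u * entire (Bessel_coef (nu + 1)) (u * u))); [ring|].
  rewrite El, Cinv_r by exact C2_neq_0; ring.
- rewrite E0, E1, Ez.
  transitivity ((u * l) * nu * p * entire (Bessel_coef nu) (u * u) * (2 * / 2)); [ring|].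
  rewrite El, Cinv_r by exact C2_neq_0; ring.
Qed.

(** * Differentiability at the origin *)

Lemma Bessel_identities_0 (L : C -> C) (nu : C) :
  @ex_derive C_AbsRing C_NormedModule (C_BesselJ L nu) (RtoC 0) -> Bessel_identities L nu 0.
Proof.
intros [D HD]; exists D; split; [exact HD|].
rewrite mult_C_BesselJ_0; split; ring.
Qed.

Lemma is_series_drop_zeros (a : nat -> C) (l : C) (k : nat) :
  (forall s, (s < k)%nat -> a s = 0) ->
  @is_series C_AbsRing C_NormedModule (fun t => a (t + k)%nat) l ->
  @is_series C_AbsRing C_NormedModule a l.
Proof.
revert a; induction k as [|k IH]; intros a Ha H.
- revert H; apply is_C_series_ext; intros n; f_equal; lia.
- apply (@is_series_decr_1 C_AbsRing C_NormedModule).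
  rewrite Ha by lia.
  match goal with |- is_series _ ?m => replace m with l end.
  2:{ change (l = l + - 0); ring. }
  apply IH; [intros s Hs; apply Ha; lia|].
  revert H; apply is_C_series_ext; intros n; f_equal; lia.
Qed.

(* For [n >= 0] take [k = 0], [m = n]; for [n < 0] take [k = m = - n], the first
   [- n] coefficients of J_n being zero.  The powers of z/2 in J_n are then
   [m + 2 t] with [t >= 0], and no branch of log is involved. *)
Lemma Bessel_coef_integer (n : Z) : exists k m : nat,
  RtoC (IZR n) + RtoC (2 * INR k) = RtoC (INR m) /\
  forall s, (s < k)%nat -> Bessel_coef (RtoC (IZR n)) s = 0.
Proof.
destruct (Z.le_gt_cases 0 n) as [h|h].
- exists 0%nat, (Z.to_nat n); split; [|intros s Hs; lia].
  rewrite (INR_IZR_INZ (Z.to_nat n)), Z2Nat.id by exact h; simpl; rewrite Rmult_0_r; ring.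
- set (k := Z.to_nat (- n)); exists k, k.
  assert (E : IZR n = (- INR k)%R).
  { unfold k; rewrite INR_IZR_INZ, Z2Nat.id, opp_IZR by lia; ring. }
  split; [rewrite E, RtoC_opp, RtoC_mult; ring|].
  intros s Hs; unfold Bessel_coef; rewrite E.
  replace (RtoC (- INR k) + RtoC (INR s) + 1) with (- RtoC (INR (k - S s))).
  + rewrite rGamma_nonpos; ring.
  + rewrite minus_INR, S_INR, RtoC_opp, RtoC_minus, RtoC_plus by lia; ring.
Qed.

Lemma exp_bounded_drop (a : nat -> C) (M : R) (k : nat) : exp_bounded M a ->
  exp_bounded M (fun t => a (t + k)%nat).
Proof.
intros H n; eapply Rle_trans; [apply H|].
assert (HM : (0 <= M)%R).
{ pose proof (H 0%nat) as H0; simpl in H0; pose proof (Cmod_ge_0 (a 0%nat)); lra. }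
apply Rmult_le_compat_l; [exact HM|].
apply Rinv_le_contravar; [apply INR_fact_lt_0|].
apply le_INR, fact_le; lia.
Qed.

(** A factorization that holds at 0 and around it, with [m] and [a] independent of z; [L] only has
    to be a logarithm pointwise, not continuous. *)
Lemma C_BesselJ_integer (L : C -> C) (n : Z) : exists (m : nat) (M : R) (a : nat -> C),
  exp_bounded M a /\
  forall z, (z / 2 = 0 \/ Cexp (L (z / 2)) = z / 2) ->
    C_BesselJ L (RtoC (IZR n)) z = (z / 2) ^ m * entire a (z / 2 * (z / 2)).
Proof.
destruct (Bessel_coef_integer n) as [k [m [E H0]]].
destruct (Bessel_coef_bounded (RtoC (IZR n))) as [M HM].
exists m, M, (fun t => Bessel_coef (RtoC (IZR n)) (t + k)%nat).
split; [apply exp_bounded_drop, HM|].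
intros z Hz; apply is_C_series_unique, (is_series_drop_zeros _ _ k).
- intros s Hs; unfold Bessel_term; rewrite H0 by exact Hs; ring.
- apply (is_C_series_ext (fun t => (z / 2) ^ m *
    (Bessel_coef (RtoC (IZR n)) (t + k)%nat * (z / 2 * (z / 2)) ^ t))).
  + intros t; unfold Bessel_term.
    replace (RtoC (IZR n) + RtoC (2 * INR (t + k))) with (RtoC (INR (m + 2 * t))).
    * rewrite Cpower_INR by exact Hz.
      replace (z / 2 * (z / 2)) with ((z / 2) ^ 2) by (simpl; ring).
      rewrite Cpow_add_r, Cpow_mult_r; ring.
    * rewrite plus_INR, RtoC_plus, <- E, mult_INR, plus_INR, Rmult_plus_distr_l, RtoC_plus.
      change (INR 2) with (1 + 1)%R; replace (1 + 1)%R with 2%R by ring; ring.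
  + apply (@is_series_scal C_AbsRing C_NormedModule ((z / 2) ^ m)), is_series_entire with M,
      exp_bounded_drop, HM.
Qed.

Lemma ex_C_derive_pow_half (m : nat) (z : C) :
  @ex_derive C_AbsRing C_NormedModule (fun y => (y / 2) ^ m) z.
Proof.
induction m as [|m [D HD]].
- exists (RtoC 0); apply (@is_derive_const C_AbsRing C_NormedModule (RtoC 1)).
- eexists; apply (is_derive_ext (fun y : C => y / 2 * (y / 2) ^ m));
    [intros y; symmetry; apply Cpow_S|].
  apply (is_C_derive_mult (fun y => y / 2)); [apply is_C_derive_half|exact HD].
Qed.

Lemma locally_half (P : C -> Prop) : @locally' C_UniformSpace (RtoC 0) P ->
  exists d : R, (0 < d)%R /\
    forall y : C, (Cmod y < d)%R -> y / 2 = 0 \/ (y <> 0 /\ P (y / 2)).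
Proof.
intros H; destruct (proj1 (locally_C_Cmod _ _) H) as [d [Hd HP]].
exists d; split; [exact Hd|]; intros y Hy.
destruct (Ceq_dec y 0) as [->|h]; [left; apply half_0|right; split; [exact h|]].
apply HP; [|apply half_neq_0, h].
replace (y / 2 - 0) with (y * RtoC (/ 2)) by (rewrite RtoC_inv by lra; unfold Cdiv; ring).
rewrite Cmod_mult, Cmod_R, Rabs_right by lra; pose proof (Cmod_ge_0 y); lra.
Qed.

Lemma ex_derive_C_BesselJ_integer (L : C -> C) (n : Z) :
  @locally' C_UniformSpace (RtoC 0) (fun w : C => Cexp (L w) = w) ->
  @ex_derive C_AbsRing C_NormedModule (C_BesselJ L (RtoC (IZR n))) (RtoC 0).
Proof.
intros H; destruct (locally_half _ H) as [d [Hd Hy]].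
destruct (C_BesselJ_integer L n) as [m [M [a [Ha E]]]].
destruct (ex_C_derive_pow_half m (RtoC 0)) as [D HD].
eexists; apply (is_derive_ext_loc (fun y => (y / 2) ^ m * entire a (y / 2 * (y / 2)))).
- apply (locally_C (RtoC 0) (fun t => _ = C_BesselJ L (RtoC (IZR n)) t)), locally_C_Cmod.
  exists d; split; [exact Hd|]; intros y Hyd; symmetry; apply E.
  replace (y - 0) with y in Hyd by ring; destruct (Hy y Hyd); tauto.
- apply (is_C_derive_mult (fun y => (y / 2) ^ m)); [exact HD|].
  apply (is_C_derive_comp (entire a) (fun y => y / 2 * (y / 2)));
    [apply is_derive_entire with M, Ha|apply is_C_derive_half_sqr].
Qed.

Lemma Cmod_entire_le (M : R) (a : nat -> C) (w : C) : exp_bounded M a ->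
  (Cmod (entire a w) <= M * exp (Cmod w))%R.
Proof.
intros H; apply (Cmod_is_series_le _ _ _ _ (is_series_entire M a w H)
  (@is_series_scal R_AbsRing R_NormedModule M _ _ (is_series_exp (Cmod w)))).
intros n; apply exp_bounded_term, H.
Qed.

(** |u^nu| is exp(Re nu ln|u| - Im nu arg u). One factor |u| is split off for the difference
    quotient; the rest tends to 0 with u when Re nu > 1. *)
Lemma Cmod_Cpower_le (L : C -> C) (u nu : C) (B : R) :
  Cexp (L u) = u -> (Rabs (Im (L u)) <= B)%R ->
  (Cmod (Cexp (nu * L u)) <=
   Cmod u * exp ((Re nu - 1) * ln (Cmod u)) * exp (Rabs (Im nu) * B))%R.
Proof.
intros HL HB.
assert (E : Cmod u = exp (Re (L u))) by (rewrite <- Cmod_Cexp, HL; reflexivity).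
rewrite Cmod_Cexp, E, ln_exp, <- !exp_plus.
apply exp_le.
replace (Re (nu * L u)) with (Re nu * Re (L u) - Im nu * Im (L u))%R by reflexivity.
assert (- (Im nu * Im (L u)) <= Rabs (Im nu) * B)%R; [|lra].
eapply Rle_trans; [apply Rle_abs|]; rewrite Rabs_Ropp, Rabs_mult.
apply Rmult_le_compat_l; [apply Rabs_pos|exact HB].
Qed.

(* Here [J_nu(z) = O(|z|^(Re nu))] with [Re nu > 1], so the derivative at 0 vanishes. *)
Lemma is_derive_C_BesselJ_0 (L : C -> C) (nu : C) (B : R) : (1 < Re nu)%R ->
  @locally' C_UniformSpace (RtoC 0)
    (fun w : C => Cexp (L w) = w /\ (Rabs (Im (L w)) <= B)%R) ->
  @is_derive C_AbsRing C_NormedModule (C_BesselJ L nu) (RtoC 0) (RtoC 0).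
Proof.
intros Hnu H; destruct (locally_half _ H) as [d [Hd Hy]].
destruct (Bessel_coef_bounded nu) as [M HM].
assert (HM0 : (0 <= M)%R).
{ pose proof (HM 0%nat) as H0; simpl in H0; pose proof (Cmod_ge_0 (Bessel_coef nu 0)); lra. }
(* [K] collects the bound from the argument and a bound for F_nu on the unit disc; M + 1 makes it
   positive. *)
set (K := (exp (Rabs (Im nu) * B) * ((M + 1) * exp 1))%R).
assert (HK : (0 < K)%R).
{ unfold K; apply Rmult_lt_0_compat; [apply exp_pos|].
  apply Rmult_lt_0_compat; [lra|apply exp_pos]. }
apply is_C_derive_eps; intros eps Heps.
(* The radius solves r^(Re nu - 1) = eps/K. *)
set (r := exp (ln (eps / K) / (Re nu - 1))).
assert (Hr : (0 < r)%R) by apply exp_pos.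
exists (Rmin d (Rmin 1 r)); split; [repeat apply Rmin_pos; lra|].
intros y Hyd.
rewrite (C_BesselJ_0 L nu) by lra.
replace (C_BesselJ L nu y - 0 - (y - 0) * 0) with (C_BesselJ L nu y) by ring.
replace (y - 0) with y in * by ring.
assert (H1 := Rlt_le_trans _ _ _ Hyd (Rmin_l _ _)).
assert (H2 := Rlt_le_trans _ _ _ Hyd (Rmin_r _ _)).
assert (H3 := Rlt_le_trans _ _ _ H2 (Rmin_l _ _)).
assert (H4 := Rlt_le_trans _ _ _ H2 (Rmin_r _ _)).
destruct (Ceq_dec y 0) as [->|hy].
{ rewrite C_BesselJ_0, Cmod_0 by lra; lra. }
destruct (Hy y H1) as [h|[_ [HL HB]]]; [contradict h; apply half_neq_0, hy|].
rewrite C_BesselJ_eq, Cpower_neq_0 by (try apply half_neq_0; assumption).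
set (u := y / 2) in *.
assert (Eu : Cmod u = (Cmod y / 2)%R).
{ unfold u, Cdiv; rewrite Cmod_mult, Cmod_inv, Cmod_R, Rabs_right by
    (try lra; exact C2_neq_0); reflexivity. }
assert (Hu0 : (0 < Cmod u)%R) by (apply Cmod_gt_0; apply half_neq_0, hy).
assert (F1 : (exp ((Re nu - 1) * ln (Cmod u)) * K <= eps)%R).
{ apply Rle_trans with (eps / K * K)%R; [|right; field; lra].
  apply Rmult_le_compat_r; [lra|].
  rewrite <- (exp_ln (eps / K)) by (apply Rdiv_lt_0_compat; assumption).
  apply exp_le.
  replace (ln (eps / K)) with ((Re nu - 1) * (ln (eps / K) / (Re nu - 1)))%R by (field; lra).
  apply Rmult_le_compat_l; [lra|].
  rewrite <- (ln_exp (ln (eps / K) / (Re nu - 1))); fold r.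
  apply Rlt_le, ln_increasing; lra. }
assert (F2 : (Cmod (entire (Bessel_coef nu) (u * u)) <= (M + 1) * exp 1)%R).
{ eapply Rle_trans; [apply Cmod_entire_le, HM|].
  apply Rmult_le_compat; [lra|apply Rlt_le, exp_pos|lra|].
  apply exp_le; rewrite Cmod_mult; nra. }
rewrite Cmod_mult.
eapply Rle_trans; [apply Rmult_le_compat;
  [apply Cmod_ge_0|apply Cmod_ge_0|apply Cmod_Cpower_le; [exact HL|exact HB]|exact F2]|].
replace (Cmod u * exp ((Re nu - 1) * ln (Cmod u)) * exp (Rabs (Im nu) * B) * ((M + 1) * exp 1))%R
  with (Cmod u * (exp ((Re nu - 1) * ln (Cmod u)) * K))%R by (unfold K; ring).
apply Rle_trans with (Cmod u * eps)%R; [apply Rmult_le_compat_l; lra|].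
rewrite Eu; pose proof (Cmod_ge_0 y); nra.
Qed.

Lemma Bessel_identities_of_powers_defined (L : C -> C) (nu z : C) :
  powers_defined L nu z -> Bessel_identities L nu z.
Proof.
intros [[Hz HL]|[[-> [[n ->] HL]]|[-> [Hnu [B HB]]]]].
- apply Bessel_identities_neq_0; assumption.
- apply Bessel_identities_0, ex_derive_C_BesselJ_integer, HL.
- apply Bessel_identities_0; exists (RtoC 0); apply is_derive_C_BesselJ_0 with B; assumption.
Qed.

(** For the bicomplex derivative the splitting into components must hold in a neighbourhood, not
    just at the point. *)
Lemma powers_defined_near (L : C -> C) (nu z : C) : powers_defined L nu z ->
  exists d : R, (0 < d)%R /\
    forall y : C, (Cmod (y - z) < d)%R -> y / 2 = 0 \/ Cexp (L (y / 2)) = y / 2.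
Proof.
intros [[Hz HL]|H].
- destruct (proj1 (locally_C_Cmod _ _) HL) as [d [Hd Hy]].
  exists d; split; [exact Hd|]; intros y Hyd; right; apply Hy.
  replace (y / 2 - z / 2) with ((y - z) * RtoC (/ 2))
    by (rewrite RtoC_inv by lra; unfold Cdiv; ring).
  rewrite Cmod_mult, Cmod_R, Rabs_right by lra; pose proof (Cmod_ge_0 (y - z)); lra.
- assert (H' : z = 0 /\ @locally' C_UniformSpace (RtoC 0) (fun w : C => Cexp (L w) = w)).
  { destruct H as [[-> [_ H]]|[-> [_ [B H]]]]; split; try reflexivity; [exact H|].
    revert H; apply filter_imp; tauto. }
  destruct H' as [-> HL]; destruct (locally_half _ HL) as [d [Hd Hy]].
  exists d; split; [exact Hd|]; intros y Hyd; replace (y - 0) with y in Hyd by ring.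
  destruct (Hy y Hyd); tauto.
Qed.

(** * Idempotent components *)

Lemma idem1_plus (Z W : BC) : idem1 (Z + W)%BC = idem1 Z + idem1 W.
Proof. unfold idem1, BCplus; simpl; ring. Qed.

Lemma idem2_plus (Z W : BC) : idem2 (Z + W)%BC = idem2 Z + idem2 W.
Proof. unfold idem2, BCplus; simpl; ring. Qed.

Lemma idem1_minus (Z W : BC) : idem1 (Z - W)%BC = idem1 Z - idem1 W.
Proof. unfold idem1, BCminus, BCplus, BCopp; simpl; ring. Qed.

Lemma idem2_minus (Z W : BC) : idem2 (Z - W)%BC = idem2 Z - idem2 W.
Proof. unfold idem2, BCminus, BCplus, BCopp; simpl; ring. Qed.

Lemma idem1_mult (Z W : BC) : idem1 (Z * W)%BC = idem1 Z * idem1 W.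
Proof.
destruct Z as [a b], W as [c d]; unfold idem1, BCmult; simpl.
transitivity (a * c + (- (1)) * (b * d) - Ci * (a * d + b * c)); [ring|].
change (- (1)) with (- RtoC 1); rewrite <- Ci2; ring.
Qed.

Lemma idem2_mult (Z W : BC) : idem2 (Z * W)%BC = idem2 Z * idem2 W.
Proof.
destruct Z as [a b], W as [c d]; unfold idem2, BCmult; simpl.
transitivity (a * c + (- (1)) * (b * d) + Ci * (a * d + b * c)); [ring|].
change (- (1)) with (- RtoC 1); rewrite <- Ci2; ring.
Qed.

Lemma idem1_CtoBC (z : C) : idem1 z = z.
Proof. unfold idem1, CtoBC; simpl; ring. Qed.

Lemma idem2_CtoBC (z : C) : idem2 z = z.
Proof. unfold idem2, CtoBC; simpl; ring. Qed.

Lemma idem_ext (Z W : BC) : idem1 Z = idem1 W -> idem2 Z = idem2 W -> Z = W.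
Proof. intros H1 H2; rewrite <- (of_idemE Z), <- (of_idemE W), H1, H2; reflexivity. Qed.

Lemma zero_divisors_idem (Z : BC) : zero_divisors Z <-> idem1 Z * idem2 Z = 0.
Proof.
destruct Z as [a b]; unfold zero_divisors, idem1, idem2; simpl.
replace ((a - Ci * b) * (a + Ci * b)) with (a * a - (Ci * Ci) * (b * b)) by ring.
rewrite Ci2; replace (a * a - - RtoC 1 * (b * b)) with (a * a + b * b) by ring; tauto.
Qed.

(** The components are multiplicative, so they can be applied to W (1/W) = 1; both components of [W]
    are nonzero off the zero divisors. *)
Lemma idem_div (Z W : BC) : ~ zero_divisors W ->
  idem1 (Z / W)%BC = idem1 Z / idem1 W /\ idem2 (Z / W)%BC = idem2 Z / idem2 W.
Proof.
intros HW; pose proof (BCinv_r W HW) as E.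
assert (H1 : idem1 W <> 0) by (intros h; apply HW, zero_divisors_idem; rewrite h; ring).
assert (H2 : idem2 W <> 0) by (intros h; apply HW, zero_divisors_idem; rewrite h; ring).
pose proof (f_equal idem1 E) as E1; pose proof (f_equal idem2 E) as E2.
rewrite idem1_mult, idem1_CtoBC in E1; rewrite idem2_mult, idem2_CtoBC in E2.
unfold BCdiv; rewrite idem1_mult, idem2_mult; split; unfold Cdiv; f_equal.
- transitivity (/ idem1 W * (idem1 W * idem1 (/ W)%BC)); [field; exact H1|rewrite E1; ring].
- transitivity (/ idem2 W * (idem2 W * idem2 (/ W)%BC)); [field; exact H2|rewrite E2; ring].
Qed.

(** Series and balls in [BC] are defined on the coordinates l1, l2, so limits of components must be
    carried back to them. *)
Lemma of_idem_coord (x y : C) : of_idem x y = (/ 2 * (x + y), Ci * / 2 * (x - y)).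
Proof.
unfold of_idem; rewrite e1E, e2E; unfold BCplus, BCmult, CtoBC; simpl.
f_equal; unfold Cdiv; ring.
Qed.

Lemma BC_Series_of_idem (a b : nat -> C) (x y : C) :
  @is_series C_AbsRing C_NormedModule a x -> @is_series C_AbsRing C_NormedModule b y ->
  BC_Series (fun n => of_idem (a n) (b n)) = of_idem x y.
Proof.
intros Ha Hb; rewrite of_idem_coord; unfold BC_Series; f_equal; apply is_C_series_unique.
- apply (is_C_series_ext (fun n => / 2 * (a n + b n)));
    [intros n; rewrite of_idem_coord; reflexivity|].
  apply (@is_series_scal C_AbsRing C_NormedModule (/ 2)),
    (@is_series_plus C_AbsRing C_NormedModule); assumption.
- apply (is_C_series_ext (fun n => Ci * / 2 * (a n - b n)));
    [intros n; rewrite of_idem_coord; reflexivity|].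
  apply (@is_series_scal C_AbsRing C_NormedModule (Ci * / 2)),
    (@is_series_minus C_AbsRing C_NormedModule); assumption.
Qed.

Lemma not_zero_divisor_2 : ~ zero_divisors (RtoC 2).
Proof.
intros H; apply zero_divisors_idem in H; rewrite idem1_CtoBC, idem2_CtoBC in H.
revert H; apply Cmult_neq_0; exact C2_neq_0.
Qed.

(** The terms split without any condition; the hypotheses provide convergence of both component
    series, which the splitting of the sum uses. *)
Lemma BesselJ_of_idem (L1 L2 : C -> C) (V Z : BC) :
  (idem1 Z / 2 = 0 \/ Cexp (L1 (idem1 Z / 2)) = idem1 Z / 2) ->
  (idem2 Z / 2 = 0 \/ Cexp (L2 (idem2 Z / 2)) = idem2 Z / 2) ->
  BesselJ L1 L2 V Z =
  of_idem (C_BesselJ L1 (idem1 V) (idem1 Z)) (C_BesselJ L2 (idem2 V) (idem2 Z)).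
Proof.
intros H1 H2.
rewrite <- (BC_Series_of_idem (Bessel_term L1 (idem1 V) (idem1 Z))
  (Bessel_term L2 (idem2 V) (idem2 Z))); try (apply is_series_C_BesselJ; assumption).
unfold BesselJ.
assert (E : forall s,
  (RtoC ((-1) ^ s / INR (fact s))%R * BC_rGamma (V + RtoC (INR s) + RtoC 1)
     * BCpower L1 L2 (Z / RtoC 2) (V + RtoC (2 * INR s)%R))%BC =
  of_idem (Bessel_term L1 (idem1 V) (idem1 Z) s) (Bessel_term L2 (idem2 V) (idem2 Z) s)).
{ intros s; destruct (idem_div Z (RtoC 2) not_zero_divisor_2) as [D1 D2].
  rewrite idem1_CtoBC in D1; rewrite idem2_CtoBC in D2.
  apply idem_ext; [rewrite idem1_of_idem|rewrite idem2_of_idem];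
    unfold BC_rGamma, BCpower, Bessel_term, Bessel_coef;
    rewrite ?idem1_mult, ?idem1_of_idem, ?idem1_plus, ?idem1_CtoBC, ?D1,
      ?idem2_mult, ?idem2_of_idem, ?idem2_plus, ?idem2_CtoBC, ?D2; reflexivity. }
unfold BC_Series, C_Series, C_Lim_seq; do 2 f_equal; f_equal; apply Lim_seq_ext; intros n;
  f_equal; apply sum_n_ext; intros s; rewrite E; reflexivity.
Qed.

(** * The bicomplex derivative from its components *)

Lemma ball_C_Cmod (x y : C) (e : R) : @ball C_UniformSpace x e y -> (Cmod (y - x) < 2 * e)%R.
Proof.
destruct x as [a b], y as [c d]; intros [H1 H2]; simpl in H1, H2.
eapply Rle_lt_trans; [apply Cmod_le_Rabs|].
assert (Rabs (c - a) < e)%R by exact H1.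
assert (Rabs (d - b) < e)%R by exact H2.
unfold Cminus, Cplus, Copp; cbn [Re Im fst snd]; unfold Rminus in *; lra.
Qed.

Lemma is_C_derive_quotient (f : C -> C) (z D : C) :
  @is_derive C_AbsRing C_NormedModule f z D -> forall eps : R, (0 < eps)%R ->
  exists d : R, (0 < d)%R /\ forall y : C, (Cmod (y - z) < d)%R -> y - z <> 0 ->
    (Cmod ((f y - f z) / (y - z) - D) <= eps)%R.
Proof.
intros H eps Heps; destruct (proj1 (is_C_derive_eps f z D) H eps Heps) as [d [Hd Hy]].
exists d; split; [exact Hd|]; intros y Hyd Hyz.
pose proof (Cmod_gt_0 (y - z)) as P; apply P in Hyz as Hm.
replace ((f y - f z) / (y - z) - D) with ((f y - f z - (y - z) * D) / (y - z)) by (field; exact Hyz).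
rewrite Cmod_div by exact Hyz.
apply Rmult_le_reg_r with (Cmod (y - z)); [exact Hm|].
unfold Rdiv; rewrite Rmult_assoc, Rinv_l, Rmult_1_r by lra; apply Hy, Hyd.
Qed.

Lemma Cmod_half_add_le (x y : C) (e : R) : (Cmod x <= e)%R -> (Cmod y <= e)%R ->
  (Cmod (/ 2 * (x + y)) <= e)%R /\ (Cmod (Ci * / 2 * (x - y)) <= e)%R.
Proof.
intros Hx Hy.
assert (E2 : Cmod (/ 2) = (/ 2)%R).
{ rewrite <- RtoC_inv, Cmod_R, Rabs_right by lra; reflexivity. }
pose proof (Cmod_triangle x y); pose proof (Cmod_triangle x (- y)) as T.
rewrite Cmod_opp in T; rewrite !Cmod_mult, E2, Cmod_Ci; unfold Cminus; split; lra.
Qed.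

Lemma is_BC_derive_of_idem (g : BC -> BC) (f1 f2 : C -> C) (Z0 : BC) (D1 D2 : C) (d : R) :
  (0 < d)%R ->
  (forall Z, (Cmod (idem1 Z - idem1 Z0) < d)%R -> (Cmod (idem2 Z - idem2 Z0) < d)%R ->
    g Z = of_idem (f1 (idem1 Z)) (f2 (idem2 Z))) ->
  @is_derive C_AbsRing C_NormedModule f1 (idem1 Z0) D1 ->
  @is_derive C_AbsRing C_NormedModule f2 (idem2 Z0) D2 ->
  is_BC_derive g Z0 (of_idem D1 D2).
Proof.
intros Hd Hg H1 H2 P [eps HP].
(* Half of [eps] turns the non-strict quotient bounds into the strict inequality of a ball. *)
assert (Heps : (0 < eps / 2)%R) by (pose proof (cond_pos eps); lra).
destruct (is_C_derive_quotient _ _ _ H1 _ Heps) as [d1 [Hd1 Q1]].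
destruct (is_C_derive_quotient _ _ _ H2 _ Heps) as [d2 [Hd2 Q2]].
(* One factor 2 is lost from square balls to [Cmod], another because each idempotent component
   combines two coordinates. *)
assert (Hr : (0 < Rmin d (Rmin d1 d2) / 4)%R).
{ assert (0 < Rmin d (Rmin d1 d2))%R by (repeat apply Rmin_pos; assumption); lra. }
exists (mkposreal _ Hr); intros Z HZ Hnz; apply HP.
assert (HI : (Cmod (idem1 Z - idem1 Z0) < Rmin d (Rmin d1 d2))%R /\
             (Cmod (idem2 Z - idem2 Z0) < Rmin d (Rmin d1 d2))%R).
{ destruct HZ as [B1 B2]; apply ball_C_Cmod in B1, B2; simpl in B1, B2.
  unfold idem1, idem2.
  replace (fst Z - Ci * snd Z - (fst Z0 - Ci * snd Z0))
    with ((fst Z - fst Z0) + - (Ci * (snd Z - snd Z0))) by ring.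
  replace (fst Z + Ci * snd Z - (fst Z0 + Ci * snd Z0))
    with ((fst Z - fst Z0) + Ci * (snd Z - snd Z0)) by ring.
  split; (eapply Rle_lt_trans; [apply Cmod_triangle|]);
    rewrite ?Cmod_opp, Cmod_mult, Cmod_Ci; lra. }
destruct HI as [I1 I2].
pose proof (Rmin_l d (Rmin d1 d2)); pose proof (Rmin_r d (Rmin d1 d2)).
pose proof (Rmin_l d1 d2); pose proof (Rmin_r d1 d2).
assert (Hz1 : idem1 Z - idem1 Z0 <> 0).
{ intros h; apply Hnz, zero_divisors_idem; rewrite idem1_minus, h; ring. }
assert (Hz2 : idem2 Z - idem2 Z0 <> 0).
{ intros h; apply Hnz, zero_divisors_idem; rewrite idem2_minus, h; ring. }
assert (K1 := Q1 (idem1 Z) ltac:(lra) Hz1); assert (K2 := Q2 (idem2 Z) ltac:(lra) Hz2).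
destruct (idem_div (g Z - g Z0)%BC (Z - Z0)%BC Hnz) as [E1 E2].
rewrite <- (of_idemE ((g Z - g Z0) / (Z - Z0))%BC), E1, E2.
rewrite !idem1_minus, !idem2_minus.
rewrite (Hg Z) by lra.
rewrite (Hg Z0) by (match goal with |- (Cmod (?a - ?a) < _)%R =>
  replace (a - a) with (RtoC 0) by ring; rewrite Cmod_0; exact Hd end).
rewrite !idem1_of_idem, !idem2_of_idem.
set (q1 := (f1 (idem1 Z) - f1 (idem1 Z0)) / (idem1 Z - idem1 Z0)) in *.
set (q2 := (f2 (idem2 Z) - f2 (idem2 Z0)) / (idem2 Z - idem2 Z0)) in *.
destruct (Cmod_half_add_le _ _ _ K1 K2) as [N1 N2].
rewrite !of_idem_coord; split; apply C_NormedModule_mixin_compat1; simpl.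
- change (Cmod (/ 2 * (q1 + q2) - / 2 * (D1 + D2)) < eps)%R.
  replace (/ 2 * (q1 + q2) - / 2 * (D1 + D2)) with (/ 2 * (q1 - D1 + (q2 - D2))) by ring; lra.
- change (Cmod (Ci * / 2 * (q1 - q2) - Ci * / 2 * (D1 - D2)) < eps)%R.
  replace (Ci * / 2 * (q1 - q2) - Ci * / 2 * (D1 - D2))
    with (Ci * / 2 * (q1 - D1 - (q2 - D2))) by ring; lra.
Qed.

Theorem theorem4p1 (L1 L2 : C -> C) (Z V : BC)
  (h1 : powers_defined L1 (idem1 V) (idem1 Z))
  (h2 : powers_defined L2 (idem2 V) (idem2 Z)) :
  exists J' : BC,
    is_BC_derive (BesselJ L1 L2 V) Z J' /\
    (Z * J' + V * BesselJ L1 L2 V Z = Z * BesselJ L1 L2 (V - RtoC 1) Z)%BC /\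
    (Z * J' + Z * BesselJ L1 L2 (V + RtoC 1) Z = V * BesselJ L1 L2 V Z)%BC.
Proof.
destruct (Bessel_identities_of_powers_defined _ _ _ h1) as [D1 [HD1 [A1 B1]]].
destruct (Bessel_identities_of_powers_defined _ _ _ h2) as [D2 [HD2 [A2 B2]]].
destruct (powers_defined_near _ _ _ h1) as [d1 [Hd1 G1]].
destruct (powers_defined_near _ _ _ h2) as [d2 [Hd2 G2]].
assert (Self : forall z d, (0 < d)%R -> (Cmod (z - z) < d)%R).
{ intros z d Hd; replace (z - z) with (RtoC 0) by ring; rewrite Cmod_0; exact Hd. }
exists (of_idem D1 D2); split.
- apply (is_BC_derive_of_idem _ (C_BesselJ L1 (idem1 V)) (C_BesselJ L2 (idem2 V)) Z D1 D2
    (Rmin d1 d2)); [apply Rmin_pos; assumption| |exact HD1|exact HD2].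
  intros W W1 W2; apply BesselJ_of_idem; [apply G1|apply G2];
    (eapply Rlt_le_trans; [eassumption|]); [apply Rmin_l|apply Rmin_r].
- rewrite !BesselJ_of_idem by first [apply G1, Self, Hd1|apply G2, Self, Hd2].
  split; apply idem_ext;
    rewrite ?idem1_plus, ?idem1_mult, ?idem1_of_idem, ?idem1_plus, ?idem1_minus, ?idem1_CtoBC,
      ?idem2_plus, ?idem2_mult, ?idem2_of_idem, ?idem2_plus, ?idem2_minus, ?idem2_CtoBC;
    assumption.
Qed.
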